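(* Let $V$ be a vertex operator algebra, let $p$ be a positive integer, let $\omega_p\in\mathbb{C}$ be a primitive $p$-th root of unity, and let $\nu$ be an automorphism of $V$ with $\nu^p=1_V$. Let $M$ be a complex vector space (not assumed to be graded) equipped with a linear map $$Y_M(\cdot,x):V\to(\mathrm{End}\,M)[[x^{1/p},x^{-1/p}]],\qquad v\mapsto Y_M(v,x)=\sum_{n\in\frac1p\mathbb{Z}}v_n^\nu x^{-n-1},$$ such that the truncation condition holds: for every $v\in V$ and $w\in M$, $v_n^\nu w=0$ for $n\in\frac1p\mathbb{Z}$ sufficiently large. (a) Suppose that for all $u,v\in V$ there is $k'(u,v)\in\mathbb{N}$ such that modified weak associativity holds for the ordered pair $(u,v)$ with exponent $k'(u,v)$, and that for all $u,v\in V$ there is $k(u,v)\in\mathbb{N}$ (possibly different from $k'(u,v)$) such that weak commutativity holds for $(u,v)$ with exponent $k(u,v)$. Then modified weak associativity also holds for every $(u,v)$ with exponent $k(u,v)$ (i.e. $k'(u,v)$ may be changed, in particular lowered, to $k(u,v)$), and the twisted Jacobi identity holds for all $u,v\in V$. If, additionally, $M$ is $\mathbb{Q}$-graded, $M=\coprod_{n\in\mathbb{Q}}M_{(n)}$, with $M_{(n)}=0$ for $n$ sufficiently negative and $\dim M_{(n)}<\infty$ for all $n$, if $L_M(0)v=nv$ for all $v\in M_{(n)}$, $n\in\mathbb{Q}$ (where $L_M(0)=\omega_1^\nu$, $\omega$ being the conformal vector of $V$), and if the vacuum property $Y_M(\mathbf 1,x)=1_M$ holds, then $M$ is a $\nu$-twisted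 $V$-module. (b) Conversely, if the twisted Jacobi identity holds for all $u,v\in V$, then for all $u,v\in V$ weak commutativity holds for some exponent in $\mathbb{N}$ and, denoting by $k(u,v)$ the smallest such exponent, modified weak associativity holds for $(u,v)$ with exponent $k(u,v)$.
   Context: $\mathbb{N}$ denotes the nonnegative integers. A vertex operator algebra $(V,Y,\mathbf 1,\omega)$ is in the standard sense of Frenkel–Lepowsky–Meurman: $\mathbb{Z}$-graded with finite-dimensional homogeneous subspaces vanishing in sufficiently negative degree, with conformal vector $\omega$, $Y(\omega,x)=\sum_n L(n)x^{-n-2}$, central charge $c_V$; $Y(v,x)=\sum_{n\in\mathbb{Z}}v_nx^{-n-1}$. An automorphism of $V$ is a linear automorphism $\nu$ of $V$ fixing $\mathbf 1$ and $\omega$ with $\nu Y(v,x)\nu^{-1}=Y(\nu v,x)$ for $v \in V$. Formal calculus conventions. $x^{1/p}$ is a formal variable whose $p$-th power is $x$. $\delta(x)=\sum_{n\in\mathbb{Z}}x^n$. Binomial expansion convention: powers (integral or fractional) of binomials are expanded in nonnegative integral powers of the second variable. The formal limit $\lim_{x_1^{1/p}\to\omega_p^s(x_2+x_0)^{1/p}}G$ means that each integral power of $x_1^{1/p}$ in the formal series $G$ is replaced by the corresponding power of $\omega_p^s(x_2+x_0)^{1/p}$; it exists if, after application to any vector $w\in M$, the coefficient of each monomial in the result is a finite sum. Weak commutativity for $(u,v)$ with exponent $k\in\mathbb{N}$: $$(x_2-x_1)^kY_M(v,x_2)Y_M(u,x_1)=(x_2-x_1)^kY_M(u,x_1)Y_M(v,x_2).$$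 Modified weak associativity for the ordered pair $(u,v)$ with exponent $k\in\mathbb{N}$: for every $s\in\mathbb{Z}$ the following limit exists and $$\lim_{x_1^{1/p}\to\omega_p^s(x_2+x_0)^{1/p}}\Big((x_1-x_2)^kY_M(u,x_1)Y_M(v,x_2)\Big)=x_0^kY_M(Y(\nu^{-s}u,x_0)v,x_2).$$ Twisted Jacobi identity: $$x_0^{-1}\delta\Big(\tfrac{x_1-x_2}{x_0}\Big)Y_M(u,x_1)Y_M(v,x_2)-x_0^{-1}\delta\Big(\tfrac{x_2-x_1}{-x_0}\Big)Y_M(v,x_2)Y_M(u,x_1)=\frac1p x_2^{-1}\sum_{r=0}^{p-1}\delta\Big(\omega_p^r\Big(\tfrac{x_1-x_0}{x_2}\Big)^{1/p}\Big)Y_M(Y(\nu^ru,x_0)v,x_2).$$ A ($\mathbb{Q}$-graded) $\nu$-twisted $V$-module is a $\mathbb{Q}$-graded vector space $M=\coprod_{n\in\mathbb{Q}}M_{(n)}$ with $M_{(n)}=0$ for $n$ sufficiently negative and $\dim M_{(n)}<\infty$, equipped with a linear map $Y_M(\cdot,x):V\to(\mathrm{End}\,M)[[x^{1/p},x^{-1/p}]]$ satisfying: the truncation condition; $Y_M(\mathbf 1,x)=1_M$; $Y_M(\omega,x)=\sum_{n\in\mathbb{Z}}L_M(n)x^{-n-2}$ where $L_M(n)=\omega_{n+1}^\nu$, with $[L_M(m),L_M(n)]=(m-n)L_M(m+n)+c_V\frac{m^3-m}{12}\delta_{m+n,0}1_M$; $L_M(0)v=nv$ for $v\in M_{(n)}$;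 $Y_M(L(-1)u,x)=\frac{d}{dx}Y_M(u,x)$ for $u\in V$; and the twisted Jacobi identity for all $u,v\in V$. *)

(* Defs.v *)
From mathcomp Require Export all_boot all_order all_algebra.
From mathcomp Require Export boolp classical_sets cardinality fsbigop reals.
From mathcomp.real_closed Require Export complex.

Set Implicit Arguments.
Unset Strict Implicit.
Unset Printing Implicit Defensive.

Import Order.TTheory GRing.Theory Num.Theory.
Local Open Scope classical_set_scope.
Local Open Scope ring_scope.

(* Formal calculus.  A monomial x_0^a (x_1^{1/p})^b (x_2^{1/p})^c is encoded
   by its exponents (a, b, c) : int * int * int; in particular x_1 and x_2
   are the p-th powers of the formal variables x_1^{1/p} and x_2^{1/p}.
   For p = 1 these are ordinary series in x_0, x_1, x_2. *)

Notation mon := (int * int * int)%type.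

Definition x0 : mon := (1, 0, 0).
Definition rx1 : mon := (0, 1, 0). (* x_1^{1/p} *)
Definition rx2 : mon := (0, 0, 1). (* x_2^{1/p} *)
Definition x1 (p : nat) : mon := rx1 *+ p.
Definition x2 (p : nat) : mon := rx2 *+ p.

Definition series (W : Type) : Type := mon -> W.

Section FormalSums.
Context {W : zmodType} {I : choiceType}.

Definition fsum_exists (F : I -> series W) : Prop :=
  forall e, finite_set [set i | F i e != 0].

(* [\sum_(i \in setT)] is the sum of a finitely supported family (and is 0,
   by convention, on other families). *)
Definition fsum (F : I -> series W) : series W :=
  fun e => \sum_(i \in [set: I]) F i e.

End FormalSums.

Section FormalCalculus.
Context {K : fieldType} {W : lmodType K}.
Implicit Types (F : series W) (d rx y : mon) (a z : K) (n : int) (p : nat).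

Definition scale a F : series W := fun e => a *: F e.

Definition mulmon d F : series W := fun e => F (e - d).

(* the generalized binomial coefficient a (a - 1) ... (a - i + 1) / i! *)
Definition gbinom a (i : nat) : K := (\prod_(j < i) (a - j%:R)) / (i`!)%:R.

(* With x := rx^p, so that x^{n/p - i} = rx^{n - p i}, the i-th term of the
   expansion of (x + a y)^{n/p} in nonnegative integral powers of y,
   multiplied by F.  Integral powers (x + a y)^n are the case p := 1,
   rx := x. *)
Definition binterm p rx a y n (i : nat) F : series W :=
  scale (gbinom (n%:~R / p%:R) i * a ^+ i)
    (mulmon (rx *~ (n - p%:Z * i%:Z) + y *+ i) F).

Definition binpow p rx a y n F : series W :=
  fsum (fun i : nat => binterm p rx a y n i F).

(* (delta T F) is delta(t) F, where (T n) is multiplication by t^n *)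
Definition delta (T : int -> series W -> series W) F : series W :=
  fsum (fun n : int => T n F).

(* x_0^{-1} delta((x_1 - x_2) / x_0) F *)
Definition delta12 p F : series W :=
  mulmon (- x0)
    (delta (fun n G => mulmon (x0 *~ - n) (binpow 1 (x1 p) (-1) (x2 p) n G)) F).

(* x_0^{-1} delta((x_2 - x_1) / (- x_0)) F *)
Definition delta21 p F : series W :=
  mulmon (- x0)
    (delta (fun n G => scale ((-1) ^ (- n))
       (mulmon (x0 *~ - n) (binpow 1 (x2 p) (-1) (x1 p) n G))) F).

(* x_2^{-1} delta(z ((x_1 - x_0) / x_2)^{1/p}) F *)
Definition delta10 p z F : series W :=
  mulmon (- x2 p)
    (delta (fun n G => scale (z ^ n)
       (mulmon (rx2 *~ - n) (binpow p rx1 (-1) x0 n G))) F).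

(* the coefficient of (x_1^{1/p})^n, a series in x_0 and x_2^{1/p} *)
Definition coef1 n F : series W :=
  fun e => let: (a, b, c) := e in if b == 0 then F (a, n, c) else 0.

(* lim_{x_1^{1/p} -> z (x_2 + x_0)^{1/p}} F: the power (x_1^{1/p})^n is
   replaced by z^n (x_2 + x_0)^{n/p}.  The family of all terms of the result
   is indexed by n and by the index i of the binomial expansion. *)
Definition limterm p z F (ni : int * nat) : series W :=
  scale (z ^ ni.1) (binterm p rx2 1 x0 ni.1 ni.2 (coef1 ni.1 F)).

Definition lim_exists p z F : Prop := fsum_exists (limterm p z F).

Definition flim p z F : series W := fsum (limterm p z F).

End FormalCalculus.

Section Gradings.
Context {K : fieldType} {W : lmodType K} {I : numDomainType}.

Definition subspace (A : set W) : Prop :=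
  A 0 /\ forall (a : K) u v, A u -> A v -> A (a *: u + v).

Definition finite_dim (A : set W) : Prop :=
  exists s : seq W, forall v, A v ->
    exists c : 'I_(size s) -> K, v = \sum_i c i *: s`_i.

Record is_grading (G : I -> set W) : Prop := IsGrading {
  grading_subspace : forall n, subspace (G n);
  grading_direct_sum : forall v, exists! f : I -> W,
    [/\ finite_set [set n | f n != 0],
        forall n, G n (f n) &
        v = \sum_(n \in [set: I]) f n];
  grading_bounded : exists N : I, forall n v, n < N -> G n v -> v = 0;
  grading_finite_dim : forall n, finite_dim (G n) }.

End Gradings.

Section VertexOperators.
Context {K : fieldType}.

(* A map v |-> Y(v, x) = \sum_{n in (1/p) Z} v_n x^{-n-1} is encoded by its
   modes: (Y v j) is v_{j/p}. *)
Definition modes (V W : lmodType K) : Type := V -> int -> {linear W -> W}.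

Definition modes_linear (V W : lmodType K) (Y : modes V W) : Prop :=
  forall n w, linear (fun v => Y v n w).

Definition truncation (V W : lmodType K) (Y : modes V W) : Prop :=
  forall v w, exists N : int, forall n, N <= n -> Y v n w = 0.

(* the coefficient of (x^{1/p})^e in Y(v, x) w: it is v_{j/p} w with
   - j/p - 1 = e/p *)
Definition coef (V W : lmodType K) (p : nat) (Y : modes V W) (v : V) (e : int)
  (w : W) : W := Y v (- e - p%:Z) w.

Definition vacuum_property (V W : lmodType K) (p : nat) (Y : modes V W)
    (vac : V) : Prop :=
  forall e w, coef p Y vac e w = if e == 0 then w else 0.

(* Y(Lm1 u, x) = d/dx Y(u, x) *)
Definition derivative_property (V W : lmodType K) (p : nat) (Y : modes V W)
    (Lm1 : V -> V) : Prop :=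
  forall u e w,
    coef p Y (Lm1 u) e w =
    ((e + p%:Z)%:~R / p%:R) *: coef p Y u (e + p%:Z) w.

Definition virasoro (W : lmodType K) (L : int -> W -> W) (c : K) : Prop :=
  forall m n w,
    L m (L n w) - L n (L m w) =
    (m - n)%:~R *: L (m + n) w +
    (if m + n == 0 then (c * ((m ^+ 3 - m)%:~R / 12%:R)) *: w else 0).

Section Products.
Context {V W : lmodType K} (p : nat) (Y : modes V W).
Implicit Types (u v : V) (w : W).

(* Y(u, x_1) Y(v, x_2) w *)
Definition prod12 u v w : series W :=
  fun e => let: (a, b, c) := e in
    if a == 0 then coef p Y u b (coef p Y v c w) else 0.

(* Y(v, x_2) Y(u, x_1) w *)
Definition prod21 u v w : series W :=
  fun e => let: (a, b, c) := e in
    if a == 0 then coef p Y v c (coef p Y u b w) else 0.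

(* Y(YV(u, x_0) v, x_2) w, where YV has integral modes *)
Definition iterate (YV : modes V V) u v w : series W :=
  fun e => let: (a, b, c) := e in
    if b == 0 then coef p Y (coef 1 YV u a v) c w else 0.

Definition jacobi_lhs u v w : series W :=
  fun e => delta12 p (prod12 u v w) e - delta21 p (prod21 u v w) e.

Definition weak_commutativity u v (k : nat) : Prop :=
  forall w e,
    binpow 1 (x2 p) (-1) (x1 p) k (prod21 u v w) e =
    binpow 1 (x2 p) (-1) (x1 p) k (prod12 u v w) e.

End Products.
End VertexOperators.

Record voa (K : fieldType) := VOA {
  voa_sort :> lmodType K;
  voa_Y : modes voa_sort voa_sort;
  voa_vac : voa_sort;
  voa_conf : voa_sort;
  voa_cc : K;
  voa_gr : int -> set voa_sort;
  voa_L := fun n : int => voa_Y voa_conf (n + 1);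
  voa_grading : is_grading voa_gr;
  voa_linear : modes_linear voa_Y;
  voa_truncation : truncation voa_Y;
  voa_vac_gr : voa_gr 0 voa_vac;
  voa_conf_gr : voa_gr 2 voa_conf;
  voa_vacuum : vacuum_property 1 voa_Y voa_vac;
  (* Y(v, x) 1 is a power series in x with constant term v *)
  voa_creation : forall v,
    (forall e, e < 0 -> coef 1 voa_Y v e voa_vac = 0) /\
    coef 1 voa_Y v 0 voa_vac = v;
  voa_jacobi : forall u v w e,
    jacobi_lhs 1 voa_Y u v w e =
    delta10 1 1 (iterate 1 voa_Y voa_Y u v w) e;
  voa_virasoro : virasoro voa_L voa_cc;
  voa_L0 : forall n v, voa_gr n v -> voa_L 0 v = n%:~R *: v;
  voa_derivative : derivative_property 1 voa_Y (voa_L (-1)) }.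

Record voa_aut (K : fieldType) (V : voa K) := VoaAut {
  aut_fun :> {linear V -> V};
  aut_inv : V -> V;
  aut_funK : cancel aut_fun aut_inv;
  aut_invK : cancel aut_inv aut_fun;
  aut_vac : aut_fun (voa_vac V) = voa_vac V;
  aut_conf : aut_fun (voa_conf V) = voa_conf V;
  aut_Y : forall v n w, aut_fun (voa_Y v n (aut_inv w)) = voa_Y (aut_fun v) n w }.

Definition aut_expz (K : fieldType) (V : voa K) (nu : voa_aut V) (s : int) :
    V -> V :=
  match s with
  | Posz n => iter n nu
  | Negz n => iter n.+1 (aut_inv nu)
  end.

Section Twisted.
Context {K : fieldType} {V : voa K} (p : nat) (omega_p : K) (nu : voa_aut V).
Context {M : lmodType K} (YM : modes V M).

Definition modified_weak_associativity (u v : V) (k : nat) : Prop :=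
  forall (s : int) (w : M),
    let G := binpow 1 (x1 p) (-1) (x2 p) k (prod12 p YM u v w) in
    lim_exists p (omega_p ^ s) G /\
    forall e, flim p (omega_p ^ s) G e =
      mulmon (x0 *+ k) (iterate p YM (@voa_Y K V) (aut_expz nu (- s) u) v w) e.

Definition twisted_jacobi (u v : V) : Prop :=
  forall w e,
    jacobi_lhs p YM u v w e =
    p%:R^-1 *: \sum_(r < p) delta10 p (omega_p ^+ r)
      (iterate p YM (@voa_Y K V) (aut_expz nu r u) v w) e.

(* L_M(n) is the mode omega_{n+1} *)
Definition LM (n : int) : M -> M := YM (voa_conf V) (p%:Z * (n + 1)).

Record twisted_module (MG : rat -> set M) : Prop := TwistedModule {
  tw_grading : is_grading MG;
  tw_linear : modes_linear YM;
  tw_truncation : truncation YM;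
  tw_vacuum : vacuum_property p YM (voa_vac V);
  (* Y_M(omega, x) = \sum_{n in Z} L_M(n) x^{-n-2}: the nonintegral modes of
     omega vanish *)
  tw_conf : forall j w, ~~ (p%:Z %| j)%Z -> YM (voa_conf V) j w = 0;
  tw_virasoro : virasoro LM (voa_cc V);
  tw_L0 : forall n v, MG n v -> LM 0 v = ratr n *: v;
  tw_derivative : derivative_property p YM (@voa_L K V (-1));
  tw_jacobi : forall u v, twisted_jacobi u v }.

End Twisted.

(* Main.v *)
(* Put P = Y_M(u, x_1) Y_M(v, x_2) w and let k be an exponent for which weak
   commutativity holds.  Then G = (x_1 - x_2)^k P has only finitely many nonzero
   coefficients of each total degree, so that its limits
   x_1^{1/p} -> omega_p^s (x_2 + x_0)^{1/p} exist and
   lim (x_1 - x_2) G = x_0 lim G; comparing (x_1 - x_2)^{k'} G with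
   (x_1 - x_2)^k (x_1 - x_2)^{k'} P lets k' be replaced by k in modified weak
   associativity.  Moreover x_0^k times the left-hand side of the Jacobi
   identity is the difference of the two expansions of
   x_0^{-1} delta((x_1 - x_2) / x_0), applied to G, which by the Vandermonde
   convolution equals
   (1/p) \sum_r x_2^{-1} delta(omega_p^r ((x_1 - x_0) / x_2)^{1/p})
     lim_{x_1^{1/p} -> omega_p^{-r} (x_2 + x_0)^{1/p}} G.
   This yields the Jacobi identity from modified weak associativity; conversely
   the r-th summands can be recovered from the sum by Fourier inversion over the
   p-th roots of unity, one power of x_0 at a time.

   The module axioms come from modified weak associativity for (u, 1), whose
   coefficients of x_0^0 and x_0^1 relate Y_M(nu^{-s} u, x) to Y_M(u, x) and
   Y_M(L(-1) u, x) to the derivative of Y_M(u, x), and from the coefficient of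
   x_0^{-1} in the Jacobi identity for (omega, omega). *)

From mathcomp Require Import zify ring.
Require Import Defs.

Set Implicit Arguments.
Unset Strict Implicit.
Unset Printing Implicit Defensive.

Import Order.TTheory GRing.Theory Num.Theory.
Local Open Scope classical_set_scope.
Local Open Scope ring_scope.
Local Open Scope complex_scope.

(** * Binomial coefficients *)

Section Binomials.
Context {K : numFieldType}.
Implicit Types (a b x y : K) (i j : nat) (n m N q : int).

Lemma gbinom0 a : gbinom a 0 = 1.
Proof. by rewrite /gbinom big_ord0 fact0 divr1. Qed.

Lemma gbinom1 a : gbinom a 1 = a.
Proof. by rewrite /gbinom big_ord1 subr0 divr1. Qed.

Lemma gbinomSl a i : i.+1%:R * gbinom a i.+1 = (a - i%:R) * gbinom a i.
Proof.
rewrite /gbinom big_ord_recr factS natrM /= invfM mulrCA !mulrA.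
by rewrite [_ * (a - _)]mulrC mulfK // pnatr_eq0.
Qed.

Lemma gbinom_pascal a i : gbinom (a + 1) i.+1 = gbinom a i.+1 + gbinom a i.
Proof.
elim: i => [|i IHi]; first by rewrite !gbinom1 gbinom0.
have i2 : i.+2%:R != 0 :> K by rewrite pnatr_eq0.
apply: (mulfI i2); rewrite mulrDr !gbinomSl IHi.
rewrite [RHS](_ : _ = (a - i%:R) * gbinom a i.+1 + i.+1%:R * gbinom a i.+1).
  by rewrite gbinomSl -natr1; ring.
by rewrite -!natr1; ring.
Qed.

Lemma gbinom_small k i : (k < i)%N -> gbinom (k%:R : K) i = 0.
Proof.
move=> lt_ki; rewrite /gbinom (bigD1 (Ordinal lt_ki)) //= subrr.
by rewrite !mul0r.
Qed.

(** Induction after multiplying by i + 1, split as j + (i + 1 - j) in each term. The tops are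
    arbitrary scalars because fractions n/p occur below. *)
Lemma gbinom_vandermonde x y i :
  \sum_(j < i.+1) gbinom x j * gbinom y (i - j) = gbinom (x + y) i.
Proof.
elim: i => [|i IHi]; first by rewrite big_ord1 !gbinom0 mulr1.
have i1 : i.+1%:R != 0 :> K by rewrite pnatr_eq0.
apply: (mulfI i1); rewrite gbinomSl -IHi !mulr_sumr.
transitivity (\sum_(j < i.+2) (j%:R * gbinom x j * gbinom y (i.+1 - j) +
    gbinom x j * ((i.+1 - j)%:R * gbinom y (i.+1 - j)))).
  apply: eq_bigr => j _; rewrite natrB; last by rewrite -ltnS.
  by ring.
rewrite big_split big_ord_recl /= !mul0r add0r [X in _ + X]big_ord_recr /=.
rewrite subnn mul0r mulr0 addr0 -big_split /=; apply: eq_bigr => j _.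
have le_ji : (j <= i)%N by rewrite -ltnS.
rewrite subSS gbinomSl subSn // gbinomSl natrB //.
by ring.
Qed.

(** The factors agree up to sign in reverse order. This brings the coefficients of the delta
    function into Vandermonde form. *)
Lemma gbinomN a i : (-1) ^+ i * gbinom (a + i%:R) i = gbinom (- a - 1) i.
Proof.
rewrite /gbinom mulrA; congr (_ / _).
rewrite (reindex_inj rev_ord_inj) /= -{1}(card_ord i) -prodrN.
apply: eq_bigr => j _.
by rewrite natrB // -natr1; ring.
Qed.

(* the coefficient of t^n in (1 - t)^N *)
Definition abinom N n : K :=
  if n is Posz i then gbinom N%:~R i * (-1) ^+ i else 0.

Lemma abinom_pascal N n : abinom (N + 1) n = abinom N n - abinom N (n - 1).
Proof.
case: n => [[|i]|i].
- by rewrite /= !gbinom0 subr0.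
- have -> : i.+1%:Z - 1 = i by lia.
  by rewrite /= intrD gbinom_pascal exprS; ring.
have -> : Negz i - 1 = Negz i.+1 by lia.
  by rewrite /= subr0.
Qed.

Lemma abinom0 n : abinom 0 n = (n == 0)%:R.
Proof.
case: n => [[|i]|i] //=; first by rewrite gbinom0 mulr1.
by rewrite (@gbinom_small 0) // mul0r.
Qed.

Lemma abinomN1 n : abinom (-1) n = (0 <= n)%R%:R.
Proof.
case: n => [i|i] //=; elim: i => [|i IHi]; first by rewrite gbinom0 mulr1.
have i1 : i.+1%:R != 0 :> K by rewrite pnatr_eq0.
apply: (mulfI i1); rewrite mulrA gbinomSl.
transitivity (i.+1%:R * (gbinom (-1)%:~R i * (-1) ^+ i) : K).
  by rewrite exprS -natr1 rmorphN1; ring.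
by rewrite IHi.
Qed.

(* The difference of the two expansions of (x_1 - x_2)^N.  Both sides satisfy
   the recurrence f (N + 1) q = f N (q + 1) - f N q and agree for N = 0, N = -1
   and for q = 1. *)
Lemma abinom_delta N q :
  abinom N (q + N) - (-1) ^ N * abinom N (- q) =
  if N is Negz a then gbinom (q - 1)%:~R a else 0.
Proof.
pose T N q := abinom N (q + N) - (-1) ^ N * abinom N (- q).
have TS m r : T m (r + 1) = T m r + T (m + 1) r.
  have e1 : r + (m + 1) - 1 = r + m by lia.
  have e2 : r + (m + 1) = r + 1 + m by lia.
  rewrite /T !abinom_pascal e1 e2 (opprD r 1).
  by rewrite expfzDr ?oppr_eq0 ?oner_eq0 // expr1z; ring.
rewrite -/(T N q); case: N => [k|k].
  elim: k q => [|k IHk] q.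
    by rewrite /T !abinom0 addr0 oppr_eq0 expr0z mul1r subrr.
  have := TS k q; rewrite !IHk add0r => /esym.
  by rewrite -PoszD addn1.
elim: k q => [|k IHk] q.
  (* For N = -1 the two geometric series contribute the indicators of q >= 1 and q <= 0, which add
     up to 1. *)
  rewrite gbinom0 /T NegzE !abinomN1 subr_ge0 oppr_ge0 exprN1.
  rewrite invrN1 mulN1r opprK.
  have -> : (1 <= q) = ~~ (q <= 0) by lia.
  by case: (q <= 0); rewrite ?addr0 ?add0r.
have T1 : T (Negz k.+1) 1 = 0.
  by rewrite /T; rewrite (_ : 1 + Negz k.+1 = Negz k) ?mulr0 ?subr0 //; lia.
have TS' r : T (Negz k.+1) (r + 1) = T (Negz k.+1) r + gbinom (r - 1)%:~R k.
  by rewrite TS -IHk; congr (_ + T _ _); lia.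
rewrite -{1}[q](subrK 1); elim/int_rect: (q - 1) => [|n IHn|n IHn].
- by rewrite add0r T1 (@gbinom_small 0).
- have -> : n.+1%:Z = n%:Z + 1 by lia.
  by rewrite TS' IHn addrK intrD gbinom_pascal.
have := TS' (- n%:Z); rewrite IHn.
have -> : - n.+1%:Z + 1 = - n%:Z by lia.
have -> : - n.+1%:Z = - n%:Z - 1 by lia.
rewrite -{1}[- n%:Z](subrK 1) intrD gbinom_pascal => /eqP.
by rewrite -subr_eq addrK => /eqP.
Qed.

End Binomials.

(** * The conformal vector of a vertex operator algebra *)

Section ConformalVector.
Context {K : numFieldType} (V : voa K).
Implicit Types (m n : int) (v : V).

Local Notation L := (@voa_L K V).
Local Notation vac := (voa_vac V).
Local Notation conf := (voa_conf V).

Lemma voa_L_vac n : -1 <= n -> L n vac = 0.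
Proof.
move=> n1; have [cr0 _] := @voa_creation K V conf.
have := cr0 (- n - 2); rewrite /coef /voa_L.
have -> : - (- n - 2) - 1%N%:Z = n + 1 by lia.
by apply; lia.
Qed.

Lemma voa_L_vacN2 : L (-2) vac = conf.
Proof.
have [_ cr] := @voa_creation K V conf.
by rewrite -[RHS]cr.
Qed.

(** Write omega = L(-2) 1; since L(m) 1 = 0, only the commutator [L(m), L(-2)] contributes, with
    central term c_V (8 - 2)/12 at m = 2. *)
Lemma voa_L_conf m : -1 < m ->
  L m conf = (m + 2)%:~R *: L (m - 2) vac +
    (if m == 2 then (voa_cc V / 2) *: vac else 0).
Proof.
move=> m1; have := @voa_virasoro K V m (-2) vac.
rewrite voa_L_vacN2 [L m vac]voa_L_vac; last by lia.
rewrite [L (-2) 0]linear0 subr0 opprK => ->; congr (_ + _).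
have -> : (m + -2 == 0) = (m == 2) by lia.
case: eqP => // ->; congr (_ *: _); rewrite /exprz /=.
rewrite (_ : ((2 : int) ^+ 3 - 2)%:~R = 6 :> K) //.
have h : (12 : K) != 0 by rewrite pnatr_eq0.
by field.
Qed.

(** Y(L(-1) v, x) 1 has constant term L(-1) v and is the derivative of Y(v, x) 1. *)
Lemma voa_LN1 v : L (-1) v = coef 1 (@voa_Y K V) v 1 vac.
Proof.
have [_ <-] := @voa_creation K V (L (-1) v).
have := @voa_derivative K V v 0 vac.
by rewrite add0r divr1 scale1r.
Qed.

End ConformalVector.

(** * Finitely supported sums *)

Section FiniteSupport.
Context {K : numFieldType} {W : lmodType K}.

(** Outside this case the sums over [setT] are 0 by convention, so it guards every splitting of such
    a sum. *)
Definition finsupp {I : choiceType} (f : I -> W) : Prop :=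
  finite_set [set i | f i != 0].

Lemma finsupp_sub {I : choiceType} (f g : I -> W) :
  (forall i, f i = 0 -> g i = 0) -> finsupp f -> finsupp g.
Proof.
move=> fg; apply: sub_finite_set => i /=.
by apply: contra_neq => /fg.
Qed.

Lemma finsupp_seq {I : choiceType} (f : I -> W) : finsupp f ->
  exists2 r : seq I, uniq r & forall i, i \notin r -> f i = 0.
Proof.
move=> /finite_seqP[s fs]; exists (undup s); first exact: undup_uniq.
move=> i; rewrite mem_undup => is_; apply/eqP; apply: contraNT is_ => fi.
by have : [set i | f i != 0] i by []; rewrite fs.
Qed.

Lemma seq_finsupp {I : choiceType} (f : I -> W) (r : seq I) :
  (forall i, i \notin r -> f i = 0) -> finsupp f.
Proof.
move=> fr; apply: sub_finite_set (finite_seq r) => i /=.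
by apply: contraTT => /fr ->; rewrite eqxx.
Qed.

Lemma fsum_seq {I : choiceType} (f : I -> W) (r : seq I) : uniq r ->
  (forall i, i \notin r -> f i = 0) ->
  \sum_(i \in [set: I]) f i = \sum_(i <- r) f i.
Proof.
move=> r_uniq fr; rewrite (fsbigE r) //; last by move=> i _; apply: fr.
by apply: eq_bigl => i; rewrite in_setT.
Qed.

Lemma fsumD {I : choiceType} (f g : I -> W) : finsupp f -> finsupp g ->
  \sum_(i \in [set: I]) (f i + g i) =
  \sum_(i \in [set: I]) f i + \sum_(i \in [set: I]) g i.
Proof.
move=> /finsupp_seq[r _ fr] /finsupp_seq[s _ gs].
have rs i : i \notin undup (r ++ s) -> f i = 0 /\ g i = 0.
  by rewrite mem_undup mem_cat negb_or => /andP[/fr ? /gs ?].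
have u := undup_uniq (r ++ s).
rewrite (fsum_seq (f := f) u) => [|i /rs[]//].
rewrite (fsum_seq (f := g) u) => [|i /rs[]//].
by rewrite -big_split; apply: fsum_seq => // i /rs[-> ->]; rewrite addr0.
Qed.

Lemma finsuppD {I : choiceType} (f g : I -> W) : finsupp f -> finsupp g ->
  finsupp (fun i => f i + g i).
Proof.
move=> /finsupp_seq[r _ fr] /finsupp_seq[s _ gs].
apply: (@seq_finsupp _ _ (r ++ s)) => i.
by rewrite mem_cat negb_or => /andP[/fr -> /gs ->]; rewrite addr0.
Qed.

Lemma finsuppZ {I : choiceType} (a : I -> K) (f : I -> W) :
  finsupp f -> finsupp (fun i => a i *: f i).
Proof. by apply: finsupp_sub => i ->; rewrite scaler0. Qed.

(** A nonzero scalar preserves the support, so for an infinite support both sums take the default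
    value 0. *)
Lemma fsumZ {I : choiceType} (a : K) (f : I -> W) :
  \sum_(i \in [set: I]) a *: f i = a *: \sum_(i \in [set: I]) f i.
Proof.
have [->|a0] := eqVneq a 0.
  by rewrite scale0r fsbig1 // => i _; rewrite scale0r.
have [/finsupp_seq[r r_uniq fr]|nf] := pselect (finsupp f).
  rewrite (fsum_seq r_uniq fr) scaler_sumr; apply: fsum_seq => // i /fr ->.
  exact: scaler0.
rewrite (@fsbig_dflt _ _ _ _ _ (fun i => a *: f i)); last first.
  apply: contra_not nf; apply: sub_finite_set => i /= fi; split=> //.
  by apply/eqP; rewrite scaler_eq0 negb_or a0.
rewrite (@fsbig_dflt _ _ _ _ _ f) ?scaler0 //.
by apply: contra_not nf; apply: sub_finite_set => i /= /eqP.
Qed.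

Lemma fsum_exchange {I : choiceType} (J : Type) (s : seq J) (f : J -> I -> W) :
  (forall j, finsupp (f j)) ->
  \sum_(i \in [set: I]) \sum_(j <- s) f j i =
  \sum_(j <- s) \sum_(i \in [set: I]) f j i.
Proof.
move=> ff; elim: s => [|j s IHs].
  by rewrite big_nil fsbig1 // => i _; rewrite big_nil.
under eq_fsbigr do rewrite big_cons.
rewrite fsumD ?IHs ?big_cons //.
elim: s {IHs} => [|k s IHs].
  by apply: (@seq_finsupp _ _ [::]) => i _; rewrite big_nil.
by apply: (finsupp_sub _ (finsuppD (ff k) IHs)) => i; rewrite big_cons.
Qed.

Lemma fsum_inj {I J : choiceType} (h : I -> J) (f : J -> W) : injective h ->
  (forall j, (forall i, j <> h i) -> f j = 0) ->
  \sum_(j \in [set: J]) f j = \sum_(i \in [set: I]) f (h i).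
Proof.
move=> h_inj f0; rewrite -(@fsbig_image _ _ _ _ _ setT h) //; last first.
  by move=> i j _ _ /h_inj.
symmetry; apply: fsbig_widen => // j /= [_ nj]; apply: f0 => i ji.
by apply: nj; exists i.
Qed.

Lemma finsupp_inj {I J : choiceType} (h : I -> J) (f : J -> W) :
  injective h -> finsupp f -> finsupp (fun i => f (h i)).
Proof.
move=> h_inj ff; apply: (@finite_preimage _ _ _ h) ff => i j _ _.
exact: h_inj.
Qed.

Lemma fsum_int_shift (k : int) (f : int -> W) :
  \sum_(n \in [set: int]) f (n + k) = \sum_(n \in [set: int]) f n.
Proof.
by rewrite [RHS](@reindex_fsbigT _ _ _ _ _ (fun n => n + k)) //;
  exists (fun n => n - k) => n; rewrite ?addrK ?subrK.
Qed.

Lemma fsum_intN (f : int -> W) :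
  \sum_(n \in [set: int]) f (- n) = \sum_(n \in [set: int]) f n.
Proof.
rewrite [RHS](@reindex_fsbigT _ _ _ _ _ -%R) //.
by exists -%R => n; rewrite opprK.
Qed.

Lemma finsupp_window (f : int -> W) (A B : int) :
  (forall n, n < A -> f n = 0) -> (forall n, B <= n -> f n = 0) -> finsupp f.
Proof.
move=> fA fB; apply: (@seq_finsupp _ _ [seq A + i%:Z | i <- iota 0 `|B - A|]).
move=> n nr; have [/fA //|An] := ltP n A; have [/fB //|nB] := leP B n.
case/mapP: nr; exists `|n - A|%N; last by lia.
by rewrite mem_iota; lia.
Qed.

(* the value at 0 of (1 - S)^N g, where S is the shift and (1 - S)^N is
   expanded in nonnegative powers of S *)
Definition shiftpow (N : int) (g : int -> W) : W :=
  \sum_(n \in [set: int]) abinom N n *: g n.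

Lemma shiftpow_nat N g :
  \sum_(i \in [set: nat]) (gbinom (N%:~R : K) i * (-1) ^+ i) *: g i%:Z =
  shiftpow N g.
Proof.
rewrite /shiftpow [RHS](@fsum_inj _ _ Posz) //; first by move=> i j [].
by case=> [n /(_ n) //|n] _; rewrite scale0r.
Qed.

Definition eventually0 (g : int -> W) : Prop :=
  exists L, forall n, L <= n -> g n = 0.

(** For N >= 0 the series (1 - t)^N is a polynomial; otherwise g cuts the sum off. *)
Lemma finsupp_shiftpow N g : 0 <= N \/ eventually0 g ->
  finsupp (fun n => abinom N n *: g n).
Proof.
move=> Ng; have [L gL] : exists L, forall n, L <= n -> abinom N n *: g n = 0.
  case: Ng => [N0|[L gL]]; last by exists L => n /gL ->; rewrite scaler0.
  exists (N + 1) => -[n|n] Nn; last by rewrite scale0r.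
  case: N N0 Nn => // N _ Nn.
  by rewrite /= gbinom_small ?mul0r ?scale0r //; lia.
apply: (@finsupp_window _ 0 L) => // -[n|n] // _; exact: scale0r.
Qed.

(** This is (1 - S)^N (1 - S) = (1 - S)^(N + 1): summation by parts, then [abinom_pascal]. *)
Lemma shiftpow_diff N g : 0 <= N \/ eventually0 g ->
  shiftpow N (fun n => g n - g (n + 1)) = shiftpow (N + 1) g.
Proof.
move=> Ng; rewrite /shiftpow.
transitivity (\sum_(n \in [set: int]) (abinom N n *: g n +
    - abinom N n *: g (n + 1))).
  by apply: eq_fsbigr => n _; rewrite scalerBr scaleNr.
have f1 := finsupp_shiftpow Ng.
have f2 : finsupp (fun n => - abinom N (n - 1) *: g n).
  have f3 : finsupp (fun n => abinom N n *: g (n + 1)).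
    apply: finsupp_shiftpow; case: Ng; [by left | case=> L gL; right].
    by exists L => n Ln; apply: gL; lia.
  have := @finsupp_inj _ _ (fun n => n - 1) _ (@addIr _ (-1)) f3.
  by apply: finsupp_sub => n; rewrite subrK scaleNr => ->; rewrite oppr0.
rewrite fsumD //; last first.
  have := @finsupp_inj _ _ (fun n => n + 1) _ (@addIr _ 1) f2.
  by apply: finsupp_sub => n; rewrite addrK.
rewrite -[X in _ + X](fsum_int_shift (-1)) /=.
under [X in _ + X]eq_fsbigr do rewrite subrK.
rewrite -fsumD //; apply: eq_fsbigr => n _.
by rewrite -scalerDl -abinom_pascal.
Qed.

Lemma eq_shiftpow N f g : f =1 g -> shiftpow N f = shiftpow N g.
Proof. by move=> fg; apply: eq_fsbigr => n _; rewrite fg. Qed.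

(* h is the restriction to an antidiagonal of a series in x_1 and x_2. *)
Lemma shiftpow_delta N (h : int -> W) : finsupp h ->
  shiftpow N (fun n => h (n - N)) - (-1) ^ N *: shiftpow N (fun n => h (- n)) =
  \sum_(q \in [set: int])
    (if N is Negz a then gbinom (q - 1)%:~R a else 0 : K) *: h q.
Proof.
move=> hf; rewrite /shiftpow.
(* Both sums are reindexed by the argument q of h, so that [abinom_delta] compares their
   coefficients. *)
rewrite -(fsum_int_shift N) /=; under eq_fsbigr do rewrite addrK.
rewrite -[X in _ - _ *: X]fsum_intN /=.
under [X in _ - _ *: X]eq_fsbigr do rewrite opprK.
rewrite -scaleNr -fsumZ -fsumD; last 2 first.
- exact: finsuppZ.
- by apply: (finsupp_sub _ hf) => n ->; rewrite !scaler0.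
apply: eq_fsbigr => q _; rewrite scalerA -scalerDl mulNr.
by rewrite abinom_delta.
Qed.

End FiniteSupport.

(** * Coefficients of binomial expansions and delta functions *)

Section Coefficients.
Context {K : numFieldType} {W : lmodType K}.
Implicit Types (F : series W) (a b c n N : int) (p k : nat) (z : K).

Lemma mon_mulrn a b c k : ((a, b, c) : mon) *+ k = (a *+ k, b *+ k, c *+ k).
Proof.
elim: k => [|k IHk]; first by rewrite !mulr0n.
by rewrite !mulrS IHk.
Qed.

Lemma mon_mulrz a b c n : ((a, b, c) : mon) *~ n = (a * n, b * n, c * n).
Proof.
rewrite -!mulrzz; case: n => n; first by rewrite -!pmulrn mon_mulrn.
by rewrite NegzE !mulrNz -!pmulrn mon_mulrn.
Qed.

Lemma mon_rx1 n : rx1 *~ n = (0, n, 0).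
Proof. by rewrite mon_mulrz !mul0r mul1r. Qed.

Lemma mon_rx2 n : rx2 *~ n = (0, 0, n).
Proof. by rewrite mon_mulrz !mul0r mul1r. Qed.

Lemma mon_x0 n : x0 *~ n = (n, 0, 0).
Proof. by rewrite mon_mulrz !mul0r mul1r. Qed.

Lemma mon_x1 p : x1 p = (0, p%:Z, 0).
Proof. by rewrite /x1 pmulrn mon_rx1. Qed.

Lemma mon_x2 p : x2 p = (0, 0, p%:Z).
Proof. by rewrite /x2 pmulrn mon_rx2. Qed.

Lemma mon_x0n k : x0 *+ k = (k%:Z, 0, 0).
Proof. by rewrite pmulrn mon_x0. Qed.

Definition monE :=
  (mon_mulrz, mon_x0n, mon_x1, mon_x2, mon_x0, mon_rx1, mon_rx2).

Lemma mon_eq a b c a' b' c' :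
  a = a' -> b = b' -> c = c' -> (a, b, c) = (a', b', c').
Proof. by move=> -> -> ->. Qed.

Lemma binpow12E p N F a b c :
  binpow 1 (x1 p) (-1) (x2 p) N F (a, b, c) =
  shiftpow N (fun i => F (a, b - p%:Z * (N - i), c - p%:Z * i)).
Proof.
rewrite -shiftpow_nat; apply: eq_fsbigr => i _.
rewrite /binterm /scale /mulmon divr1; congr (_ *: F _).
rewrite pmulrn !monE; apply: mon_eq => /=; ring.
Qed.

Lemma binpow21E p N F a b c :
  binpow 1 (x2 p) (-1) (x1 p) N F (a, b, c) =
  shiftpow N (fun i => F (a, b - p%:Z * i, c - p%:Z * (N - i))).
Proof.
rewrite -shiftpow_nat; apply: eq_fsbigr => i _.
rewrite /binterm /scale /mulmon divr1; congr (_ *: F _).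
rewrite pmulrn !monE; apply: mon_eq => /=; ring.
Qed.

(* the embedding of series in x_1^{1/p} and x_2^{1/p} only *)
Definition series12 (g : int -> int -> W) : series W :=
  fun e => let: (a, b, c) := e in if a == 0 then g b c else 0.

(* the embedding of series in x_0 and x_2^{1/p} only *)
Definition series02 (h : int -> int -> W) : series W :=
  fun e => let: (a, b, c) := e in if b == 0 then h a c else 0.

(* multiplication by x_1 - x_2 *)
Definition mulx12 p (g : int -> int -> W) : int -> int -> W :=
  fun b c => g (b - p%:Z) c - g b (c - p%:Z).

Lemma shiftpow0 N (g : int -> W) : (forall n, g n = 0) -> shiftpow N g = 0.
Proof. by move=> g0; apply: fsbig1 => n _; rewrite g0 scaler0. Qed.

Lemma binpow12_series12 p N g a b c :
  binpow 1 (x1 p) (-1) (x2 p) N (series12 g) (a, b, c) =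
  series12 (fun b c =>
      shiftpow N (fun i => g (b - p%:Z * (N - i)) (c - p%:Z * i)))
    (a, b, c).
Proof.
rewrite binpow12E /=; case: eqP => // _.
exact: shiftpow0.
Qed.

Lemma binpow21_series12 p N g a b c :
  binpow 1 (x2 p) (-1) (x1 p) N (series12 g) (a, b, c) =
  series12 (fun b c =>
      shiftpow N (fun i => g (b - p%:Z * i) (c - p%:Z * (N - i))))
    (a, b, c).
Proof.
rewrite binpow21E /=; case: eqP => // _.
exact: shiftpow0.
Qed.

Lemma fsum_only {I : choiceType} (i0 : I) (f : I -> W) :
  (forall i, i != i0 -> f i = 0) -> \sum_(i \in [set: I]) f i = f i0.
Proof.
move=> f0; rewrite (@fsum_seq _ _ _ _ [:: i0]) ?big_seq1 // => i.
by rewrite inE => /f0.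
Qed.

(** The series has degree 0 in x_0, so only n = -a - 1 in the delta function reaches the exponent
    a. *)
Lemma delta12_series12 p g a b c :
  delta12 p (series12 g) (a, b, c) =
  shiftpow (- a - 1) (fun i => g (b - p%:Z * (- a - 1 - i)) (c - p%:Z * i)).
Proof.
rewrite /delta12 /mulmon /delta /fsum.
have e n : (a, b, c) - - x0 - x0 *~ - n = (a + 1 + n, b, c).
  by rewrite !monE opprK; apply: mon_eq => /=; ring.
rewrite (@fsum_only _ (- a - 1)) => [|n na].
  by rewrite e binpow12_series12 /= ifT //; lia.
by rewrite e binpow12_series12 /= ifF //; lia.
Qed.

Lemma delta21_series12 p g a b c :
  delta21 p (series12 g) (a, b, c) =
  (-1) ^ (a + 1) *: shiftpow (- a - 1)
    (fun i => g (b - p%:Z * i) (c - p%:Z * (- a - 1 - i))).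
Proof.
rewrite /delta21 /mulmon /delta /fsum.
have e n : (a, b, c) - - x0 - x0 *~ - n = (a + 1 + n, b, c).
  by rewrite !monE opprK; apply: mon_eq => /=; ring.
rewrite (@fsum_only _ (- a - 1)) /scale => [|n na].
  rewrite e binpow21_series12 /= ifT; last by lia.
  by congr (_ ^ _ *: _); lia.
by rewrite e binpow21_series12 /= ifF ?scaler0 //; lia.
Qed.

(** The series has degree 0 in x_1^{1/p}, so the i-th binomial term meets the exponent b only for n
    = b + p i, and the double sum collapses. *)
Lemma delta10_series02 p z h a b c : (0 < p)%N ->
  delta10 p z (series02 h) (a, b, c) =
  \sum_(i \in [set: nat])
    ((-1) ^+ i * gbinom (b%:~R / p%:R + i%:R) i * z ^ (b + p%:Z * i)) *:
      h (a - i%:Z) (b + c + p%:Z + p%:Z * i).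
Proof.
move=> p_gt0; rewrite /delta10 /mulmon /delta /fsum.
have p0 : p%:R != 0 :> K by rewrite pnatr_eq0 -lt0n.
have e n : (a, b, c) - - x2 p - rx2 *~ - n = (a, b, c + p%:Z + n).
  by rewrite !monE opprK; apply: mon_eq => /=; ring.
have E n i : binterm p rx1 (-1) x0 n i (series02 h) (a, b, c + p%:Z + n) =
    if b == n - p%:Z * i%:Z then (gbinom (n%:~R / p%:R) i * (-1) ^+ i) *:
      h (a - i%:Z) (c + p%:Z + n) else 0.
  rewrite /binterm /scale /mulmon !monE /=.
  have -> : b - (n - p%:Z * i%:Z + 0) == 0 = (b == n - p%:Z * i%:Z) by lia.
  by case: eqP => _; rewrite ?scaler0 //; congr (_ *: h _ _); ring.
rewrite (@fsum_inj _ _ _ _ (fun i : nat => b + p%:Z * i%:Z)); first last.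
- move=> n nb; rewrite /scale e /binpow /fsum fsbig1 ?scaler0 // => i _.
  by rewrite E ifF //; apply/negP => /eqP bn; apply: (nb i); lia.
- by move=> i j /addrI/(mulfI _) ij; apply/eqP; rewrite -eqz_nat ij //; lia.
apply: eq_fsbigr => i _; rewrite /scale e /binpow /fsum.
rewrite (@fsum_only _ i) => [|j ji].
  rewrite E ifT; last by apply/eqP; ring.
  rewrite scalerA; congr (_ *: h _ _); last by ring.
  rewrite intrD intrM mulrDl -!pmulrn [p%:R * _]mulrC mulfK //; ring.
rewrite E ifF //; apply: contraNF ji => /eqP bj.
by apply/eqP; nia.
Qed.

End Coefficients.

(** * Truncated series in two variables and their limits *)

Section Truncation.
Context {K : numFieldType} {W : lmodType K}.
Implicit Types (g : int -> int -> W).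

Definition lower_trunc1 g : Prop := exists B, forall b c, b < B -> g b c = 0.
Definition lower_trunc2 g : Prop := exists C, forall b c, c < C -> g b c = 0.

(** For nonzero z this amounts to the existence of the limit x_1^{1/p} -> z (x_2 + x_0)^{1/p}; see
    [lim_existsP]. *)
Definition diag_finsupp g : Prop := forall d, finsupp (fun n => g n (d - n)).

Lemma diag_finsupp_trunc g : lower_trunc1 g -> lower_trunc2 g -> diag_finsupp g.
Proof.
move=> [B gB] [C gC] d; apply: (@finsupp_window _ _ _ B (d - C + 1)) => n nB.
  exact: gB.
by apply: gC; lia.
Qed.

End Truncation.

(** * Multiplication by x_1 - x_2 and its effect on expansions and limits *)

Section TwoVariables.
Context {K : numFieldType} {W : lmodType K} (p : nat) (p_gt0 : (0 < p)%N).
Implicit Types (g h : int -> int -> W) (a b c d n N : int) (k : nat) (z : K).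

Let pK_neq0 : p%:R != 0 :> K.
Proof. by rewrite pnatr_eq0 -lt0n. Qed.

Lemma lower_trunc1_mulx12 g : lower_trunc1 g -> lower_trunc1 (mulx12 p g).
Proof.
case=> B gB; exists B => b c bB; rewrite /mulx12 !gB ?subr0 //; lia.
Qed.

Lemma lower_trunc2_mulx12 g : lower_trunc2 g -> lower_trunc2 (mulx12 p g).
Proof.
case=> C gC; exists C => b c cC; rewrite /mulx12 !gC ?subr0 //; lia.
Qed.

Lemma iter_mulx12_comm k l g :
  iter k (mulx12 p) (iter l (mulx12 p) g) =
  iter l (mulx12 p) (iter k (mulx12 p) g).
Proof. by rewrite -!iterD addnC. Qed.

(** Each factor x_1 - x_2 enters the exponent by [shiftpow_diff]; for negative N the lower bound on
    the powers of x_2 keeps the expansion finite. *)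
Lemma shiftpow12_mulx12 N g k b c : 0 <= N \/ lower_trunc2 g ->
  shiftpow N
    (fun i => iter k (mulx12 p) g (b - p%:Z * (N - i)) (c - p%:Z * i)) =
  shiftpow (N + k) (fun i => g (b - p%:Z * (N + k - i)) (c - p%:Z * i)).
Proof.
elim: k g => [|k IHk] g Ng; first by rewrite addr0.
rewrite iterSr IHk; last first.
  by case: Ng; [left | right; exact: lower_trunc2_mulx12].
have -> : N + k.+1 = N + k + 1 by lia.
rewrite -shiftpow_diff; last first.
  case: Ng => [N0|[C gC]]; [by left; lia | right].
  by exists (`|c - C|%N%:Z + 1) => n Ln; apply: gC; nia.
by apply: eq_shiftpow => i; rewrite /mulx12; congr (g _ _ - g _ _); ring.
Qed.

(** The sign comes from x_1 - x_2 = -(x_2 - x_1); finiteness for negative N now comes from the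
    powers of x_1. *)
Lemma shiftpow21_mulx12 N g k b c : 0 <= N \/ lower_trunc1 g ->
  shiftpow N
    (fun i => iter k (mulx12 p) g (b - p%:Z * i) (c - p%:Z * (N - i))) =
  (-1) ^+ k *:
    shiftpow (N + k) (fun i => g (b - p%:Z * i) (c - p%:Z * (N + k - i))).
Proof.
elim: k g => [|k IHk] g Ng; first by rewrite addr0 scale1r.
rewrite iterSr IHk; last first.
  by case: Ng; [left | right; exact: lower_trunc1_mulx12].
have -> : N + k.+1 = N + k + 1 by lia.
rewrite -shiftpow_diff; last first.
  case: Ng => [N0|[B gB]]; [by left; lia | right].
  by exists (`|b - B|%N%:Z + 1) => n Ln; apply: gB; nia.
rewrite exprSr -scalerA; congr (_ *: _).
rewrite /shiftpow -fsumZ.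
apply: eq_fsbigr => i _; rewrite scalerA [-1 * _]mulrC -scalerA scaleN1r opprB.
by rewrite /mulx12; congr (_ *: (g _ _ - g _ _)); ring.
Qed.

Lemma shiftpow_0 (f : int -> W) : shiftpow 0 f = f 0.
Proof.
rewrite /shiftpow (@fsum_only _ _ _ 0) => [|n n0].
  by rewrite abinom0 scale1r.
by rewrite abinom0 (negbTE n0) scale0r.
Qed.

Lemma binpow12_nat k g a b c :
  binpow 1 (x1 p) (-1) (x2 p) k (series12 g) (a, b, c) =
  series12 (iter k (mulx12 p) g) (a, b, c).
Proof.
rewrite binpow12_series12 /=; case: eqP => // _.
have := @shiftpow12_mulx12 0 g k b c (or_introl (lexx _)).
by rewrite shiftpow_0 subrr !mulr0 !subr0 add0r => ->.
Qed.

Lemma binpow21_nat k g a b c :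
  binpow 1 (x2 p) (-1) (x1 p) k (series12 g) (a, b, c) =
  (-1) ^+ k *: series12 (iter k (mulx12 p) g) (a, b, c).
Proof.
rewrite binpow21_series12 /=; case: eqP => // _; last by rewrite scaler0.
have := @shiftpow21_mulx12 0 g k b c (or_introl (lexx _)).
rewrite shiftpow_0 subrr !mulr0 !subr0 add0r => ->.
by rewrite scalerA -exprMn mulrNN mulr1 expr1n scale1r.
Qed.

Lemma diag_finsupp_mulx12 g : diag_finsupp g -> diag_finsupp (mulx12 p g).
Proof.
move=> gf d; have f1 := finsupp_inj (@addIr _ (- p%:Z)) (gf (d - p%:Z)).
have := finsuppD f1 (finsuppZ (fun=> -1) (gf (d - p%:Z))).
apply: finsupp_sub => n; rewrite /mulx12 scaleN1r.
have -> : d - p%:Z - (n - p%:Z) = d - n by lia.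
by have -> : d - p%:Z - n = d - n - p%:Z by lia.
Qed.

(* the coefficient of x_0^a (x_2^{1/p})^c in the limit of g as
   x_1^{1/p} -> z (x_2 + x_0)^{1/p} *)
Definition limop z g a c : W :=
  if a is Posz i then
    \sum_(n \in [set: int])
      (z ^ n * gbinom (n%:~R / p%:R) i) *: g n (c + p%:Z * i%:Z - n)
  else 0.

Lemma limtermE z g ni a b c :
  limterm p z (series12 g) ni (a, b, c) =
  if (b == 0) && (a == ni.2%:Z) then
    (z ^ ni.1 * gbinom (ni.1%:~R / p%:R) ni.2) *: g ni.1 (c + p%:Z * a - ni.1)
  else 0.
Proof.
case: ni => n i; rewrite /limterm /binterm /scale /mulmon /= !monE /=.
have -> : (b - (0 + 0) == 0) = (b == 0) by lia.
have -> : (a - (0 + i%:Z) == 0) = (a == i%:Z) by lia.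
case: eqP => /= _; last by rewrite !scaler0.
case: eqP => [->|_]; last by rewrite !scaler0.
rewrite expr1n mulr1 scalerA; congr (_ *: g _ _); ring.
Qed.

Lemma flimE z g a b c :
  flim p z (series12 g) (a, b, c) = series02 (limop z g) (a, b, c).
Proof.
rewrite /flim /fsum /=; under eq_fsbigr do rewrite limtermE.
case: eqP => _ /=; last by apply: fsbig1.
case: a => [i|i] /=; last by apply: fsbig1.
rewrite (@fsum_inj _ _ _ _ (fun n : int => (n, i))) /=; first last.
- case=> n j /(_ n) nj; rewrite ifF //=; apply/negP => /eqP [ij].
  by apply: nj; rewrite ij.
- by move=> n m [].
by apply: eq_fsbigr => n _; rewrite eqxx.
Qed.

(** The terms with i = 0 have coefficient z^n, hence detect every nonzero coefficient of total
    degree d. Conversely, the exponent of x_0 fixes i. *)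
Lemma lim_existsP z g : z != 0 ->
  lim_exists p z (series12 g) <-> diag_finsupp g.
Proof.
move=> z0; split=> [gl d|gf [[a b] c]].
  have gl0 : finsupp (fun ni => limterm p z (series12 g) ni (0, 0, d)).
    exact: gl.
  have := finsupp_inj (h := fun n : int => (n, 0%N)) _ gl0.
  have inj : injective (fun n : int => (n, 0%N)) by move=> n m [].
  move=> /(_ inj); apply: finsupp_sub => n; rewrite limtermE /= gbinom0 mulr1.
  rewrite mulr0 addr0 => /eqP; rewrite scaler_eq0 expfz_eq0 (negbTE z0) andbF.
  by move/eqP.
rewrite -/(finsupp _); case: a => [i|i]; last first.
  by apply: (@seq_finsupp _ _ _ _ [::]) => ni _; rewrite limtermE andbF.
have /finsupp_seq[r _ fr] := gf (c + p%:Z * i).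
apply: (@seq_finsupp _ _ _ _ [seq (n, i) | n <- r]) => -[n j] nj.
rewrite limtermE /=; case: ifP => // /andP[_ /eqP[ij]].
rewrite fr ?scaler0 //; apply: contra nj => nr.
by apply/mapP; exists n; rewrite ?ij.
Qed.

(* lim (x_1 - x_2) G = x_0 lim G *)
Lemma limop_mulx12 z g a c : z ^+ p = 1 -> diag_finsupp g ->
  limop z (mulx12 p g) a c = limop z g (a - 1) c.
Proof.
move=> zp gf; have z0 : z != 0.
  by apply: contra_eq_neq zp => ->; rewrite expr0n gtn_eqF // eq_sym oner_eq0.
case: a => [i|i]; last by rewrite /limop (_ : Negz i - 1 = Negz i.+1); [|lia].
pose d := c + p%:Z * i - p%:Z.
pose be i n : K := z ^ n * gbinom (n%:~R / p%:R) i.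
have f2 : finsupp (fun n => - be i n *: g n (d - n)) by apply: finsuppZ.
have f1 : finsupp (fun n => be i (n + p%:Z) *: g n (d - n)) by apply: finsuppZ.
transitivity (\sum_(n \in [set: int])
    (be i (n + p%:Z) - be i n) *: g n (d - n)).
  under eq_fsbigr do rewrite scalerDl.
  rewrite fsumD // -(fsum_int_shift (- p%:Z)) /= -fsumD //; last first.
    exact: (finsupp_inj (@addIr _ (- p%:Z)) f1).
  apply: eq_fsbigr => n _; rewrite subrK /mulx12 scaleNr -scalerBr.
  by congr (_ *: (g _ _ - g _ _)); rewrite /d; ring.
(* Pascal's rule at n/p, with z^p = 1 absorbing the shift by p: this is (x_2 + x_0) - x_2 = x_0. *)
have be_step n : be i (n + p%:Z) - be i n =
    if i is j.+1 then be j n else 0.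
  rewrite /be expfzDr // -exprnP zp mulr1 intrD -pmulrn mulrDl divff //.
  case: (i) => [|j]; first by rewrite !gbinom0 subrr.
  by rewrite gbinom_pascal; ring.
under eq_fsbigr do rewrite be_step.
rewrite /d; case: (i) => [|j]; first by apply: fsbig1 => n _; rewrite scale0r.
have -> : limop z g (j.+1%:Z - 1) c = limop z g j c by congr limop; lia.
apply: eq_fsbigr => n _; congr (_ *: g _ _).
have -> : j.+1%:Z = j%:Z + 1 by lia.
ring.
Qed.

Lemma diag_finsupp_iter k g :
  diag_finsupp g -> diag_finsupp (iter k (mulx12 p) g).
Proof. by move=> gf; elim: k => // k; apply: diag_finsupp_mulx12. Qed.

Lemma limop_iter z g k a c : z ^+ p = 1 -> diag_finsupp g ->
  limop z (iter k (mulx12 p) g) a c = limop z g (a - k%:Z) c.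
Proof.
move=> zp gf; elim: k a => [|k IHk] a; first by rewrite subr0.
rewrite iterS limop_mulx12 ?IHk //; last exact: diag_finsupp_iter.
by congr limop; lia.
Qed.

(** * Sums over roots of unity and of delta functions *)

Lemma prim_exprz_eq1 (om : K) n : p.-primitive_root om ->
  (om ^ n == 1) = (p%:Z %| n)%Z.
Proof.
move=> om_prim; rewrite dvdzE /=; case: n => n.
  by rewrite -exprnP (prim_order_dvd om_prim).
by rewrite NegzE -exprnN invr_eq1 (prim_order_dvd om_prim).
Qed.

(** Geometric sum: if t = om^n differs from 1, then (t - 1) times the sum is t^p - 1 = 0. *)
Lemma sum_prim_root (om : K) n : p.-primitive_root om ->
  p%:R^-1 * \sum_(r < p) (om ^+ r) ^ n = (p%:Z %| n)%Z%:R.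
Proof.
move=> om_prim.
have omp : om ^+ p = 1 := prim_expr_order om_prim.
have om0 : om != 0 by rewrite (prim_root_eq0 om_prim) gtn_eqF.
have -> : \sum_(r < p) (om ^+ r) ^ n = \sum_(r < p) (om ^ n) ^+ r.
  by apply: eq_bigr => r _; rewrite !exprnP !exprz_exp mulrC.
have omn1 := prim_exprz_eq1 n om_prim.
rewrite -omn1; case: eqP => [->|/eqP n1].
  under eq_bigr do rewrite expr1n.
  by rewrite sumr_const card_ord mulVf.
apply/eqP; rewrite mulf_eq0 invr_eq0 (negbTE pK_neq0) /=.
have : (om ^ n - 1) * \sum_(r < p) (om ^ n) ^+ r == 0.
  by rewrite -subrX1 exprnP exprzAC -exprnP omp exp1rz subrr.
by rewrite mulf_eq0 subr_eq0 (negbTE n1).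
Qed.

(* Averaging over the p-th roots of unity keeps the exponents of x_1^{1/p}
   congruent to b modulo p; the Vandermonde convolution does the rest. *)
Lemma delta10_limop (om : K) g a b c : p.-primitive_root om -> diag_finsupp g ->
  p%:R^-1 *: \sum_(r < p) delta10 p (om ^+ r)
    (series02 (limop (om ^ (- r%:Z)) g)) (a, b, c) =
  \sum_(q \in [set: int])
    (if - a - 1 is Negz i then gbinom (q - 1)%:~R i else 0 : K) *:
      g (b + p%:Z * q) (c + p%:Z + p%:Z * a - p%:Z * q).
Proof.
move=> om_prim gf.
have omp : om ^+ p = 1 := prim_expr_order om_prim.
have om0 : om != 0 by rewrite (prim_root_eq0 om_prim) gtn_eqF.
under eq_bigr do rewrite delta10_series02 //.
case: a => [a|a]; last first.
  (* For a negative exponent of x_0 the limits contribute nothing, and -a - 1 >= 0 makes the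
     right-hand side 0. *)
  rewrite [RHS]fsbig1 => [|q _].
    by rewrite big1 ?scaler0 // => r _; apply: fsbig1 => i _;
      rewrite (_ : Negz a - i%:Z = Negz (a + i)) ?scaler0 //; lia.
  by rewrite (_ : - Negz a - 1 = a) ?scale0r //; lia.
have -> : - a%:Z - 1 = Negz a by lia.
(* All coefficients of g that occur have total degree d; [co r j n] is the factor that g n (d - n)
   receives from the j-th binomial term of the r-th delta function. *)
pose d := b + c + p%:Z + p%:Z * a.
pose co (r : 'I_p) (j : 'I_a.+1) (n : int) : K :=
  (-1) ^+ j * gbinom (b%:~R / p%:R + j%:R) j * (om ^+ r) ^ (b + p%:Z * j) *
  ((om ^ (- r%:Z)) ^ n * gbinom (n%:~R / p%:R) (a - j)).
have E (r : 'I_p) :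
  \sum_(i \in [set: nat])
    ((-1) ^+ i * gbinom (b%:~R / p%:R + i%:R) i * (om ^+ r) ^ (b + p%:Z * i)) *:
      limop (om ^ (- r%:Z)) g (a%:Z - i%:Z) (b + c + p%:Z + p%:Z * i) =
  \sum_(n \in [set: int]) \sum_(j < a.+1) co r j n *: g n (d - n).
  rewrite (@fsum_seq _ _ _ _ (iota 0 a.+1)) ?iota_uniq //; last first.
    move=> i; rewrite mem_iota => ia.
    by rewrite (_ : a%:Z - i%:Z = Negz (i - a).-1) ?scaler0 //; lia.
  rewrite fsum_exchange; last by move=> j; apply: finsuppZ.
  rewrite -[iota 0 a.+1]/(index_iota 0 a.+1) big_mkord.
  apply: eq_bigr => j _; rewrite (_ : a%:Z - j%:Z = Posz (a - j)); last first.
    by have := ltn_ord j; lia.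
  rewrite -fsumZ; apply: eq_fsbigr => n _; rewrite scalerA.
  congr (_ *: g _ _); rewrite /d; have := ltn_ord j => ja.
  by rewrite -subzn; [ring | lia].
under eq_bigr do rewrite E.
rewrite -fsum_exchange => [|r]; last first.
  apply: (finsupp_sub _ (gf d)) => n ->.
  by rewrite big1 // => j _; rewrite scaler0.
(* The sum over j is Vandermonde with tops -b/p - 1 and n/p; r enters only through om^(r (b - n)),
   whose average tests whether p divides b - n. *)
have key n : p%:R^-1 * (\sum_(r < p) \sum_(j < a.+1) co r j n) =
    (p%:Z %| b - n)%Z%:R * gbinom ((n - b)%:~R / p%:R - 1) a.
  have -> : (n - b)%:~R / p%:R - 1 = (- (b%:~R / p%:R) - 1) + n%:~R / p%:R :> K.
    by rewrite rmorphB /=; ring.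
  rewrite -gbinom_vandermonde -(sum_prim_root _ om_prim) -mulrA; congr (_ * _).
  rewrite mulr_suml; apply: eq_bigr => r _; rewrite mulr_sumr.
  apply: eq_bigr => j _; rewrite /co gbinomN.
  have omr0 : om ^+ r != 0 by rewrite expf_neq0.
  have -> : (om ^+ r) ^ (b + p%:Z * j) = (om ^+ r) ^ b.
    rewrite expfzDr // -exprz_exp -!exprnP [om ^+ r ^+ p]exprAC omp.
    by rewrite !expr1n mulr1.
  have -> : (om ^+ r) ^ (b - n) = (om ^+ r) ^ b * (om ^ (- r%:Z)) ^ n.
    by rewrite expfzDr // !exprnP !exprz_exp mulrN mulNr.
  by ring.
rewrite -fsumZ (@fsum_inj _ _ _ _ (fun q => b + p%:Z * q)); first last.
- move=> n nb; under eq_bigr do rewrite -scaler_suml.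
  rewrite -scaler_suml scalerA key.
  case: (boolP (p%:Z %| b - n)%Z) => [/dvdzP[q qE]|_]; last first.
    by rewrite mul0r scale0r.
  by case: (nb (- q)); rewrite mulrN mulrC -qE; ring.
- by move=> q q' /addrI/mulfI; apply; lia.
apply: eq_fsbigr => q _; under eq_bigr do rewrite -scaler_suml.
rewrite -scaler_suml scalerA key.
rewrite (_ : b - (b + p%:Z * q) = - q * p%:Z); last by ring.
rewrite dvdz_mull // mul1r (_ : b + p%:Z * q - b = p%:Z * q); last by ring.
rewrite intrM -pmulrn mulrAC mulfV // mul1r intrB.
by congr (_ *: g _ _); rewrite /d; ring.
Qed.

End TwoVariables.

(** * Twisted modules *)

(** For a negative exponent -(n + 1) with residue m, p divides n + 1 + m, so nu^(n + 1) nu^m is the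
    identity. *)
Lemma aut_expz_modz (K : numFieldType) (V : voa K) (nu : voa_aut V) (p : nat) :
  (0 < p)%N -> (forall v, iter p nu v = v) ->
  forall n u, aut_expz nu n u = aut_expz nu (n %% p%:Z)%Z u.
Proof.
move=> p_gt0 nu_p.
have nu_pM m u : iter (m * p) nu u = u.
  by elim: m => // m IHm; rewrite mulSn iterD nu_p.
have nu_mod m u : iter (m %% p) nu u = iter m nu u.
  by rewrite [in RHS](divn_eq m p) iterD nu_pM.
have invK m u : iter m (aut_inv nu) (iter m nu u) = u.
  by elim: m u => // m IHm u; rewrite iterSr iterS aut_funK IHm.
case=> n u; first by rewrite modz_nat /= nu_mod.
have : (0 <= Negz n %% p%:Z)%Z by apply: modz_ge0; lia.
case E : (Negz n %% p%:Z)%Z => [m|//] _.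
rewrite -[RHS](invK n.+1) /aut_expz; congr (iter _ _ _).
rewrite -iterD -nu_mod.
have pd : (p%:Z %| (n.+1 + m)%N%:Z)%Z.
  have := divz_eq (Negz n) p%:Z; rewrite E => Ediv.
  by apply/dvdzP; exists (- (Negz n %/ p%:Z)%Z); lia.
by rewrite (eqP (pd : (p %| n.+1 + m)%N)).
Qed.

Section Modules.
Context {K : numFieldType} {V : voa K} (p : nat) (om : K) (nu : voa_aut V).
Context {M : lmodType K} (YM : modes V M).
Hypotheses (p_gt0 : (0 < p)%N) (om_prim : p.-primitive_root om).
Hypotheses (YM_linear : modes_linear YM) (YM_trunc : truncation YM).
Implicit Types (u v : V) (w : M) (a b c n N s : int) (k : nat).

Let omp : om ^+ p = 1 := prim_expr_order om_prim.
Let om0 : om != 0.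
Proof. by rewrite (prim_root_eq0 om_prim) gtn_eqF. Qed.
Let oms n : (om ^ n) ^+ p = 1.
Proof. by rewrite exprnP exprzAC -exprnP omp exp1rz. Qed.

(** The products and the iterate are the embeddings of these arrays by [series12] and [series02]. *)
Definition coef12 u v w b c : M := coef p YM u b (coef p YM v c w).
Definition coef21 u v w b c : M := coef p YM v c (coef p YM u b w).
Definition coef02 u v w a c : M := coef p YM (coef 1 (@voa_Y K V) u a v) c w.

Lemma coef_trunc (V' U : lmodType K) q (Y : modes V' U) (u : V') (w : U) :
  truncation Y -> exists B : int, forall b, b < B -> coef q Y u b w = 0.
Proof.
move=> Y_trunc; have [N uN] := Y_trunc u w.
by exists (- N - q%:Z + 1) => b bB; apply: uN; lia.
Qed.

Lemma coef12_trunc u v w : lower_trunc2 (coef12 u v w).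
Proof.
have [C wC] := @coef_trunc _ _ p YM v w YM_trunc.
by exists C => b c /wC; rewrite /coef12 => ->; rewrite /coef linear0.
Qed.

Lemma coef21_trunc u v w : lower_trunc1 (coef21 u v w).
Proof.
have [B wB] := @coef_trunc _ _ p YM u w YM_trunc.
by exists B => b c /wB; rewrite /coef21 => ->; rewrite /coef linear0.
Qed.

Lemma modes_linear0 n w : YM 0 n w = 0.
Proof.
have := YM_linear n w (-1) 0 0.
by rewrite scaler0 addr0 scaleN1r addNr.
Qed.

(** The truncation takes place in V, so the bound is uniform in w; this yields an exponent of weak
    commutativity independent of w. *)
Lemma coef02_trunc u v :
  exists A : int, forall a c w, a < A -> coef02 u v w a c = 0.
Proof.
have [A vA] := @coef_trunc _ _ 1 (@voa_Y K V) u v (@voa_truncation K V).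
by exists A => a c w /vA; rewrite /coef02 => ->; rewrite /coef modes_linear0.
Qed.

Lemma coef02_trunc_unif u v : exists A : int, forall (r : 'I_p) a c w,
  a < A -> coef02 (aut_expz nu r u) v w a c = 0.
Proof.
suff H m : exists A : int, forall r : nat, (r < m)%N -> forall a c w, a < A ->
    coef02 (aut_expz nu r u) v w a c = 0.
  by have [A uA] := H p; exists A => r; apply: uA.
elim: m => [|m [A uA]]; first by exists 0.
have [A' uA'] := coef02_trunc (aut_expz nu m u) v.
exists (Order.min A A') => r; rewrite ltnS leq_eqVlt => /orP[/eqP ->|rm] a c w.
  by rewrite lt_min => /andP[_]; apply: uA'.
by rewrite lt_min => /andP[aA _]; apply: uA.
Qed.

Lemma weak_commutativityP u v k :
  weak_commutativity p YM u v k <->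
  forall w,
    iter k (mulx12 p) (coef21 u v w) =2 iter k (mulx12 p) (coef12 u v w).
Proof.
split=> [wc w b c|wc w [[a b] c]].
  have := wc w (0, b, c); rewrite [LHS]binpow21_nat // [RHS]binpow21_nat //=.
  by apply: scalerI; rewrite signr_eq0.
rewrite [LHS]binpow21_nat // [RHS]binpow21_nat //=; congr (_ *: _).
by rewrite wc.
Qed.

Lemma modified_weak_associativityP u v k :
  modified_weak_associativity p om nu YM u v k <->
  forall s w, diag_finsupp (iter k (mulx12 p) (coef12 u v w)) /\
    forall a c, limop p (om ^ s) (iter k (mulx12 p) (coef12 u v w)) a c =
      coef02 (aut_expz nu (- s) u) v w (a - k%:Z) c.
Proof.
have E w : binpow 1 (x1 p) (-1) (x2 p) k (prod12 p YM u v w) =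
    series12 (iter k (mulx12 p) (coef12 u v w)).
  by apply: funext => -[[a b] c]; exact: binpow12_nat.
have oms0 s : om ^ s != 0 by rewrite expfz_neq0.
have It u' w a b c :
    mulmon (x0 *+ k) (iterate p YM (@voa_Y K V) u' v w) (a, b, c) =
    series02 (fun a c => coef02 u' v w (a - k%:Z) c) (a, b, c).
  by rewrite /mulmon !monE /= !subr0.
split=> [mwa s w|mwa s w].
  have := mwa s w; rewrite /= E => -[/lim_existsP gf mwa_s].
  split; first exact: gf.
  move=> a c; have := mwa_s (a, 0, c); rewrite It flimE //=.
have [gf mwa_s] := mwa s w; rewrite /= E; split; first exact/lim_existsP.
by move=> [[a b] c]; rewrite It flimE //= mwa_s.
Qed.

(** One order of the product bounds the powers of x_1 below, the other those of x_2; equality gives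
    both bounds. *)
Lemma diag_finsupp_weak_comm u v w k :
  iter k (mulx12 p) (coef21 u v w) =2 iter k (mulx12 p) (coef12 u v w) ->
  diag_finsupp (iter k (mulx12 p) (coef12 u v w)).
Proof.
move=> wc; apply: diag_finsupp_trunc.
  have [B GB] : lower_trunc1 (iter k (mulx12 p) (coef21 u v w)).
    elim: k {wc} => [|l IHl]; first exact: coef21_trunc.
    exact: lower_trunc1_mulx12.
  by exists B => b c bB; rewrite -wc GB.
elim: k {wc} => [|l IHl]; first exact: coef12_trunc.
exact: lower_trunc2_mulx12.
Qed.

Lemma jacobi_lhs_limop u v w k :
  iter k (mulx12 p) (coef21 u v w) =2 iter k (mulx12 p) (coef12 u v w) ->
  forall a b c, jacobi_lhs p YM u v w (a, b, c) =
    p%:R^-1 *: \sum_(r < p) delta10 p (om ^+ r)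
      (series02 (limop p (om ^ (- r%:Z)) (iter k (mulx12 p) (coef12 u v w))))
      (a + k%:Z, b, c).
Proof.
move=> wc a b c.
set G := iter k (mulx12 p) (coef12 u v w).
have Gf : diag_finsupp G := diag_finsupp_weak_comm wc.
(* N is what remains of the exponent -a - 1 of x_1 - x_2 after k factors have gone into G; h lists G
   along the antidiagonal met at (a, b, c). *)
rewrite delta10_limop //; pose N := - (a + k%:Z) - 1.
pose h q := G (b + p%:Z * q) (c + p%:Z + p%:Z * (a + k%:Z) - p%:Z * q).
rewrite -/N -(shiftpow_delta N (h := h)); last first.
  have := finsupp_inj (h := fun q => b + p%:Z * q) _
    (Gf (b + c + p%:Z + p%:Z * (a + k%:Z))).
  have inj : injective (fun q => b + p%:Z * q).
    by move=> i j /addrI/mulfI; apply; lia.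
  move=> /(_ inj); apply: finsupp_sub => q <-; rewrite /h; congr (G _ _); ring.
have aN : - a - 1 = N + k by rewrite /N; ring.
have E1 : delta12 p (prod12 p YM u v w) (a, b, c) =
    shiftpow N (fun i => G (b - p%:Z * (N - i)) (c - p%:Z * i)).
  rewrite shiftpow12_mulx12 //; last by right; exact: coef12_trunc.
  by rewrite -aN; exact: delta12_series12.
have E2 : delta21 p (prod21 p YM u v w) (a, b, c) =
    (-1) ^ N *: shiftpow N (fun i => G (b - p%:Z * i) (c - p%:Z * (N - i))).
  (* Weak commutativity turns G into the opposite product, whose powers of x_1 are bounded below as
     the expansion of (x_2 - x_1)^N requires. *)
  under eq_shiftpow do rewrite /G -wc.
  rewrite shiftpow21_mulx12 //; last by right; exact: coef21_trunc.
  rewrite -aN scalerA exprnP -expfzDr ?oppr_eq0 ?oner_eq0 //.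
  have -> : N + k = - (a + 1) by rewrite -aN; ring.
  by rewrite -exprz_inv invrN1; exact: delta21_series12.
rewrite /jacobi_lhs E1 E2; congr (_ - _ *: _); apply: eq_shiftpow => i.
- by rewrite /h /N; congr (G _ _); ring.
- by rewrite /h /N; congr (G _ _); ring.
Qed.

Lemma iterate_series02 u v w :
  iterate p YM (@voa_Y K V) u v w = series02 (coef02 u v w).
Proof. by apply: funext => -[[a b] c]. Qed.

Lemma delta10_series02_shift z k h a b c :
  delta10 p z (series02 (fun a c => h (a - k%:Z) c)) (a + k%:Z, b, c) =
  delta10 p z (series02 h) (a, b, c) :> M.
Proof.
rewrite !delta10_series02 //; apply: eq_fsbigr => i _.
by congr (_ *: h _ _); ring.
Qed.

Lemma eq_delta10_series02 z (h h' : int -> int -> M) e :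
  h =2 h' -> delta10 p z (series02 h) e = delta10 p z (series02 h') e.
Proof.
by move=> hh'; have -> : h = h' by apply: funext => a; apply: funext => c.
Qed.

Lemma delta10_series02B z (h h' : int -> int -> M) a b c :
  (exists A, forall a c, a < A -> h a c = 0) ->
  (exists A, forall a c, a < A -> h' a c = 0) ->
  delta10 p z (series02 (fun a c => h a c - h' a c)) (a, b, c) =
  delta10 p z (series02 h) (a, b, c) - delta10 p z (series02 h') (a, b, c).
Proof.
pose co (i : nat) : K :=
  (-1) ^+ i * gbinom (b%:~R / p%:R + i%:R) i * z ^ (b + p%:Z * i).
have fin (f : int -> int -> M) : (exists A, forall a c, a < A -> f a c = 0) ->
    finsupp (fun i : nat => co i *: f (a - i%:Z) (b + c + p%:Z + p%:Z * i)).
  case=> A fA; apply: (@seq_finsupp _ _ _ _ (iota 0 `|a - A|.+1)) => i.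
  by rewrite mem_iota => ia; rewrite fA ?scaler0 //; lia.
move=> hA h'A; rewrite !delta10_series02 //.
rewrite -[X in _ = _ + X]scaleN1r -[X in _ = _ + X]fsumZ -fsumD; last 2 first.
- exact: fin hA.
- exact: finsuppZ (fin _ h'A).
by apply: eq_fsbigr => i _; rewrite scaleN1r scalerBr.
Qed.

(** * Weak commutativity and modified weak associativity versus the Jacobi identity *)

Lemma weak_assoc_exponent u v k k' :
  modified_weak_associativity p om nu YM u v k' ->
  weak_commutativity p YM u v k -> modified_weak_associativity p om nu YM u v k.
Proof.
move=> /modified_weak_associativityP mwa /weak_commutativityP wc.
apply/modified_weak_associativityP => s w.
have gf := diag_finsupp_weak_comm (wc w); split=> // a c.
have [gf' mwa_s] := mwa s w.
(* Pass from x_0^a to x_0^(a + k') by inserting (x_1 - x_2)^k', exchange the two powers, and trade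
   (x_1 - x_2)^k for x_0^k. *)
rewrite -[a](addrK k'%:Z) -limop_iter // iter_mulx12_comm limop_iter // mwa_s.
by congr coef02; ring.
Qed.

Lemma weak_assoc_twisted_jacobi u v k :
  modified_weak_associativity p om nu YM u v k ->
  weak_commutativity p YM u v k -> twisted_jacobi p om nu YM u v.
Proof.
move=> /modified_weak_associativityP mwa /weak_commutativityP wc w [[a b] c].
rewrite (jacobi_lhs_limop (wc w)); congr (_ *: _); apply: eq_bigr => r _.
rewrite iterate_series02 -(@delta10_series02_shift _ k).
apply: eq_delta10_series02 => a' c'.
by have [_ ->] := mwa (- r%:Z) w; rewrite opprK.
Qed.

(** The coefficient of x_0^(-k - 1) on the left is (x_1 - x_2)^k times the commutator; the
    right-hand side has no such power once -k - 1 < A. *)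
Lemma twisted_jacobi_weak_comm u v :
  twisted_jacobi p om nu YM u v -> exists k, weak_commutativity p YM u v k.
Proof.
move=> jac.
have [A uA] := coef02_trunc_unif u v.
exists `|A|%N; apply/weak_commutativityP => w b c.
set k := `|A|%N.
have := jac w (- k%:Z - 1, b, c).
rewrite big1 ?scaler0 => [|r _]; last first.
  rewrite iterate_series02 delta10_series02 //; apply: fsbig1 => i _.
  by rewrite uA ?scaler0 //; rewrite /k; lia.
rewrite /jacobi_lhs [delta12 _ _ _]delta12_series12.
rewrite [delta21 _ _ _]delta21_series12.
rewrite (_ : - (- k%:Z - 1) - 1 = 0 + k%:Z); last by ring.
rewrite -[shiftpow _ _](@shiftpow12_mulx12 _ _ _ p_gt0 0 (coef12 u v w));
  last by left.
have := @shiftpow21_mulx12 _ _ _ p_gt0 0 (coef21 u v w) k b c.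
move=> /(_ (or_introl (lexx _))).
rewrite !shiftpow_0 subrr !mulr0 !subr0 => ->.
rewrite subrK -exprnN -exprVn invrN1 => /eqP.
by rewrite subr_eq0 => /eqP.
Qed.

(* The lowest term in x_0 of a vanishing combination of delta functions is a
   discrete Fourier transform over the p-th roots of unity. *)
Lemma delta10_inj (D : 'I_p -> int -> int -> M) :
  (exists A, forall r a c, a < A -> D r a c = 0) ->
  (forall e, \sum_(r < p) delta10 p (om ^+ r) (series02 (D r)) e = 0) ->
  forall r a c, D r a c = 0.
Proof.
move=> [A DA] D0 r a c.
suff H (n : nat) : forall a c r, a < A + n%:Z -> D r a c = 0.
  by apply: (H (`|a - A|%N.+1)); lia.
elim: n {r a c} => [|n IHn] a c r an; first by apply: DA; lia.
have {}D0 b : \sum_(r < p) (om ^+ r) ^ b *: D r a c = 0.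
  (* With this exponent of x_2^{1/p} the term i = 0 involves D r a c; those with i > 0 involve lower
     powers of x_0, already known to vanish. *)
  rewrite -[RHS](D0 (a, b, c - p%:Z - b)); apply: eq_bigr => r' _.
  rewrite delta10_series02 // (@fsum_only _ _ _ 0%N) => [|i i0].
    rewrite gbinom0 !mul1r mulr0 !subr0; congr (_ *: D _ _ _); ring.
  by rewrite IHn ?scaler0 //; lia.
(* Fourier inversion: weighting by om^(-r b) and averaging over b isolates the index r. *)
have : p%:R^-1 *: \sum_(b < p) (om ^ (- (r * b)%N%:Z)) *:
    \sum_(r' < p) (om ^+ r') ^ b *: D r' a c = 0.
  by rewrite big1 ?scaler0 // => b _; rewrite D0 scaler0.
under eq_bigr do rewrite scaler_sumr.
rewrite exchange_big /= scaler_sumr.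
have key (r' : 'I_p) : p%:R^-1 *: (\sum_(b < p) om ^ (- (r * b)%N%:Z) *:
    ((om ^+ r') ^ b *: D r' a c)) = (r' == r)%:R *: D r' a c.
  under eq_bigr do rewrite scalerA.
  rewrite -scaler_suml scalerA.
  have -> : (r' == r) = (p%:Z %| r'%:Z - r%:Z)%Z :> bool.
    by rewrite -eqz_mod_dvd !modz_small //= ltz_nat.
  rewrite -(sum_prim_root _ _ om_prim) //; congr (_ * _ *: _).
  apply: eq_bigr => b _; rewrite !exprnP !exprz_exp -expfzDr //.
  by congr (_ ^ _); rewrite PoszM; ring.
rewrite (bigD1 r) //= key eqxx scale1r big1 ?addr0 // => r' /negbTE r'r.
by rewrite key r'r scale0r.
Qed.

Lemma twisted_jacobi_weak_assoc u v k : (forall x : V, iter p nu x = x) ->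
  twisted_jacobi p om nu YM u v -> weak_commutativity p YM u v k ->
  modified_weak_associativity p om nu YM u v k.
Proof.
move=> nu_p jac /weak_commutativityP wc.
apply/modified_weak_associativityP => s w.
split=> [|a c]; first exact: diag_finsupp_weak_comm (wc w).
set G := iter k (mulx12 p) (coef12 u v w).
(* D r measures the failure of modified weak associativity at s = -r; all of these vanish by
   [delta10_inj]. *)
pose D (r : 'I_p) a c :=
  limop p (om ^ (- r%:Z)) G a c - coef02 (aut_expz nu r u) v w (a - k%:Z) c.
have [A DA] := coef02_trunc_unif u v.
have D0 : forall r a c, D r a c = 0.
  apply: delta10_inj.
    exists (Order.min 0 (A + k%:Z)) => r a' c'; rewrite lt_min => /andP[a0 aA].
    rewrite /D DA ?subr0; last by lia.
    by case: a' a0 {aA}.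
  move=> [[a' b] c'].
  (* The limits and the iterates each sum to p times the left-hand side of the Jacobi identity at
     x_0^(a' - k). *)
  transitivity (p%:R *: (jacobi_lhs p YM u v w (a' - k%:Z, b, c') -
                         jacobi_lhs p YM u v w (a' - k%:Z, b, c'))); last first.
    by rewrite subrr scaler0.
  rewrite [in X in X - _](jacobi_lhs_limop (wc w)) jac -scalerBr scalerA.
  rewrite mulfV ?pnatr_eq0 -?lt0n // scale1r -sumrB; apply: eq_bigr => r _.
  rewrite iterate_series02 -(@delta10_series02_shift _ k (coef02 _ _ _)) subrK.
  apply: (@delta10_series02B _ (limop p (om ^ (- r%:Z)) G)
    (fun a c => coef02 (aut_expz nu r u) v w (a - k%:Z) c)).
    by exists 0 => -[].
  by exists (A + k%:Z) => a1 c1 a1A; apply: DA; lia.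
(* Modulo p, s is -r; both om^s and nu^(-s) depend only on this class. *)
pose r := ((- s) %% p%:Z)%Z.
have r0 : 0 <= r by apply: modz_ge0; lia.
have rp : r < p%:Z by apply: ltz_pmod; lia.
have rp' : (`|r| < p)%N by lia.
have sE : s = p%:Z * - ((- s) %/ p%:Z)%Z - r.
  by have := divz_eq (- s) p%:Z; rewrite -/r; lia.
have omr : om ^ (- r) = om ^ s.
  by rewrite [in RHS]sE expfzDr // -exprz_exp -exprnP omp exp1rz mul1r.
have -> : aut_expz nu (- s) u = iter `|r| nu u.
  by rewrite (aut_expz_modz p_gt0 nu_p) -/r -{1}(gez0_abs r0).
have := D0 (Ordinal rp') a c; rewrite /D /= => /eqP.
by rewrite subr_eq0 gez0_abs // omr => /eqP.
Qed.

(** * Module axioms from the vacuum property *)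

Hypothesis YM_vac : vacuum_property p YM (voa_vac V).

Local Notation vac := (voa_vac V).
Local Notation conf := (voa_conf V).

Lemma coef_modes0 n w : coef p YM 0 n w = 0.
Proof. exact: modes_linear0. Qed.

Lemma coef_modesZ (x : K) u n w : coef p YM (x *: u) n w = x *: coef p YM u n w.
Proof.
have := YM_linear (- n - p%:Z) w x u 0.
by rewrite addr0 modes_linear0 // addr0.
Qed.

Lemma weak_commutativity_vac u : weak_commutativity p YM u vac 0.
Proof.
apply/weak_commutativityP => w b c; rewrite /= /coef21 /coef12 !YM_vac.
by case: eqP => // _; rewrite /coef linear0.
Qed.

(** Commutation with 1 has exponent 0, so k is lowered to 0; as Y_M(1, x_2) w = w, only the power n
    = c + p i of x_1^{1/p} contributes. *)
Lemma weak_assoc_vac u k : modified_weak_associativity p om nu YM u vac k ->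
  forall s w (i : nat) c,
    coef02 (aut_expz nu (- s) u) vac w i c =
    ((om ^ s) ^ (c + p%:Z * i%:Z) * gbinom ((c + p%:Z * i%:Z)%:~R / p%:R) i) *:
      coef p YM u (c + p%:Z * i%:Z) w.
Proof.
move=> mwa s w i c.
have := weak_assoc_exponent mwa (weak_commutativity_vac u).
move=> /modified_weak_associativityP/(_ s w) [_ /(_ i c)].
rewrite subr0 => <- /=.
rewrite (@fsum_only _ _ _ (c + p%:Z * i%:Z)) => [|n nc]; rewrite /coef12 YM_vac.
  by rewrite subrr eqxx.
by rewrite ifF ?scaler0 // ?/coef ?linear0 ?scaler0 //; lia.
Qed.

Hypothesis mwa : forall u,
  exists k, modified_weak_associativity p om nu YM u vac k.

Lemma coef_aut_expz s u c w :
  coef p YM (aut_expz nu (- s) u) c w = (om ^ s) ^ c *: coef p YM u c w.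
Proof.
have [k /weak_assoc_vac/(_ s w 0%N c)] := mwa u.
rewrite mulr0 addr0 gbinom0 mulr1 /coef02 => <-.
by have [_ ->] := @voa_creation K V (aut_expz nu (- s) u).
Qed.

Lemma module_derivative : derivative_property p YM (@voa_L K V (-1)).
Proof.
move=> u c w; have [k /weak_assoc_vac/(_ 0 w 1%N c)] := mwa u.
by rewrite expr0z exp1rz mul1r mulr1 gbinom1 /coef02 voa_LN1.
Qed.

(** As nu fixes omega, [coef_aut_expz] with s = 1 says that the coefficient of x^{e/p} equals om^e
    times itself, so it is 0 unless p divides e. *)
Lemma module_conf j w : ~~ (p%:Z %| j)%Z -> YM conf j w = 0.
Proof.
move=> pj; have := coef_aut_expz 1 conf (- j - p%:Z) w.
have -> : aut_expz nu (- 1) conf = conf.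
  by rewrite /= -{1}(aut_conf nu) aut_funK.
rewrite /coef expr1z (_ : - (- j - p%:Z) - p%:Z = j); last by ring.
move=> /eqP.
rewrite -subr_eq0 -{1}[YM _ _ _]scale1r -scalerBl scaler_eq0 subr_eq0.
case/orP => /eqP // om1; case/negP: pj.
have : (p%:Z %| - j - p%:Z)%Z by rewrite -(prim_exprz_eq1 _ om_prim) -om1.
by rewrite rpredBr ?dvdzz // rpredN.
Qed.

Lemma module_virasoro : twisted_jacobi p om nu YM conf conf ->
  virasoro (LM p YM) (voa_cc V).
Proof.
move=> jac m n w.
have p0 : p%:R != 0 :> K by rewrite pnatr_eq0 -lt0n.
have coefL l w' : coef p YM conf (p%:Z * (- l - 2)) w' = LM p YM l w'.
  by rewrite /coef /LM; congr (YM _ _ _); ring.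
have nu_conf r : aut_expz nu (Posz r) conf = conf.
  by elim: r => //= r ->; rewrite aut_conf.
(* These exponents of x_1^{1/p} and x_2^{1/p} select L_M(m) and L_M(n); at x_0^(-1) the left-hand
   side is their commutator. *)
pose b := p%:Z * (- m - 2); pose c := p%:Z * (- n - 2).
have bE : b%:~R / p%:R = - m%:~R - 2 :> K.
  by rewrite /b intrM -pmulrn mulrAC divff // mul1r rmorphB /= rmorphN.
have := jac w (-1, b, c).
rewrite /jacobi_lhs [delta12 _ _ _]delta12_series12.
rewrite [delta21 _ _ _]delta21_series12.
rewrite opprK subrr !shiftpow_0 subr0 !mulr0 !subr0 addNr expr0z scale1r.
rewrite !coefL => ->.
pose S := \sum_(i \in [set: nat]) gbinom (m + 1)%:~R i *:
  coef02 conf conf w (-1 - i%:Z) (b + c + p%:Z + p%:Z * i).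
(* The p summands coincide because nu fixes omega and p divides b. *)
have E (r : 'I_p) : delta10 p (om ^+ r)
    (iterate p YM (@voa_Y K V) (aut_expz nu r conf) conf w) (-1, b, c) = S.
  rewrite nu_conf iterate_series02 delta10_series02 //.
  apply: eq_fsbigr => i _; congr (_ *: _).
  rewrite gbinomN.
  have -> : (om ^+ r) ^ (b + p%:Z * i) = 1.
    rewrite /b -mulrDr -exprz_exp -exprnP exprAC (prim_expr_order om_prim).
    by rewrite expr1n exp1rz.
  by rewrite mulr1 bE; congr gbinom; rewrite intrD; ring.
under eq_bigr do rewrite E.
rewrite sumr_const card_ord -scaler_nat scalerA mulVf // scale1r {E}.
have SE (i : nat) : coef02 conf conf w (-1 - i%:Z) (b + c + p%:Z + p%:Z * i) =
   coef p YM (@voa_L K V (i%:Z - 1) conf) (p%:Z * (- (m + n + 3) + i%:Z)) w.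
  rewrite /coef02; congr (coef p YM _ _ _); last by rewrite /b /c; ring.
  by rewrite /coef /voa_L; congr (voa_Y _ _ _); lia.
rewrite /S; under eq_fsbigr do rewrite SE.
(* For i = 0, 1, 2, 3 the vectors L(i - 1) omega are L(-1) omega, 2 omega, 0 and (c_V / 2) 1; for
   larger i they vanish. *)
rewrite (@fsum_seq _ _ _ _ (iota 0 4)) ?iota_uniq //; last first.
  case=> [|[|[|[|i]]]] // _.
  rewrite voa_L_conf ?ifF; [|lia..].
  by rewrite voa_L_vac ?scaler0 ?addr0 ?coef_modes0 ?scaler0 //; lia.
have LN1 : coef p YM (@voa_L K V (0%N%:Z - 1) conf)
      (p%:Z * (- (m + n + 3) + 0%N%:Z)) w =
    (- (m + n) - 2)%:~R *: LM p YM (m + n) w.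
  rewrite add0r module_derivative -coefL.
  have -> : p%:Z * (- (m + n + 3) + 0%N%:Z) + p%:Z = p%:Z * (- (m + n) - 2).
    by ring.
  by rewrite [in X in X *: _]intrM -pmulrn mulrAC divff // mul1r.
have L0 : coef p YM (@voa_L K V (1%N%:Z - 1) conf)
      (p%:Z * (- (m + n + 3) + 1%N%:Z)) w =
    2%:R *: LM p YM (m + n) w.
  rewrite subrr voa_L_conf // addr0 voa_L_vacN2 coef_modesZ -coefL.
  by congr (_ *: coef p YM _ _ _); ring.
have L1 : coef p YM (@voa_L K V (2%N%:Z - 1) conf)
      (p%:Z * (- (m + n + 3) + 2%N%:Z)) w = 0.
  by rewrite voa_L_conf // voa_L_vac // scaler0 addr0 coef_modes0.
have L2 : coef p YM (@voa_L K V (3%N%:Z - 1) conf)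
      (p%:Z * (- (m + n + 3) + 3%N%:Z)) w =
    if m + n == 0 then (voa_cc V / 2) *: w else 0.
  rewrite voa_L_conf // voa_L_vac // scaler0 add0r coef_modesZ YM_vac.
  have -> : (p%:Z * (- (m + n + 3) + 3%N%:Z) == 0) = (m + n == 0) by nia.
  by case: eqP; rewrite ?scaler0.
rewrite !big_cons big_nil LN1 L0 L1 L2 scaler0 add0r addr0 gbinom0 scale1r.
rewrite addrA.
rewrite scalerA -scalerDl; congr (_ *: _ + _).
  by rewrite gbinom1 !(rmorphD, rmorphN) /=; ring.
case: eqP => _; rewrite ?scaler0 // scalerA; congr (_ *: _).
(* The central term is c_V / 2 times the binomial of m + 1 over 3, which is (m^3 - m)/6. *)
have g3 : 6 * gbinom (m + 1)%:~R 3 = (m ^+ 3 - m)%:~R :> K.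
  set x := (m + 1)%:~R; transitivity (2%:R * (3%:R * gbinom x 3)).
    by ring.
  rewrite gbinomSl; transitivity ((x - 2%:R) * (2%:R * gbinom x 2)).
    by ring.
  rewrite gbinomSl gbinom1.
  by rewrite /x !(rmorphD, rmorphXn, rmorphN) /=; ring.
have n12 : (12 : K) != 0 by rewrite pnatr_eq0.
by rewrite -g3; field.
Qed.

End Modules.

(** * Both implications and the module structure over the complex numbers *)

Theorem theorem5p1 (R : realType) (V : voa R[i]) (p : nat) (omega_p : R[i])
    (nu : voa_aut V) (M : lmodType R[i]) (YM : modes V M)
    (p_gt0 : (0 < p)%N)
    (omega_p_prim : p.-primitive_root omega_p)
    (nu_p : forall v : V, iter p nu v = v)
    (YM_linear : modes_linear YM)
    (YM_trunc : truncation YM) :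
  (forall k' k : V -> V -> nat,
     (forall u v, modified_weak_associativity p omega_p nu YM u v (k' u v)) ->
     (forall u v, weak_commutativity p YM u v (k u v)) ->
     [/\ forall u v, modified_weak_associativity p omega_p nu YM u v (k u v),
         forall u v, twisted_jacobi p omega_p nu YM u v &
         forall MG : rat -> set M,
           is_grading MG ->
           (forall n v, MG n v -> LM p YM 0 v = ratr n *: v) ->
           vacuum_property p YM (voa_vac V) ->
           twisted_module p omega_p nu YM MG])
  /\
  ((forall u v, twisted_jacobi p omega_p nu YM u v) ->
   forall u v,
     (exists k, weak_commutativity p YM u v k) /\
     (forall k, weak_commutativity p YM u v k ->
        (forall j, weak_commutativity p YM u v j -> (k <= j)%N) ->
        modified_weak_associativity p omega_p nu YM u v k)).

Proof.
split=> [k' k mwa wc|jac u v].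
  have mwa_k u v : modified_weak_associativity p omega_p nu YM u v (k u v).
    exact: (weak_assoc_exponent _ _ _ (mwa u v) (wc u v)).
  have jac u v : twisted_jacobi p omega_p nu YM u v.
    exact: (weak_assoc_twisted_jacobi _ _ _ (mwa_k u v) (wc u v)).
  have mwa_vac u : exists l,
      modified_weak_associativity p omega_p nu YM u (voa_vac V) l.
    by exists (k u (voa_vac V)).
  split=> // MG MG_grading MG_L0 YM_vac; split=> //.
  - by move=> j w; apply: (module_conf _ _ _ _ mwa_vac).
  - exact: (module_virasoro _ _ _ _ _ mwa_vac).
  - exact: (module_derivative _ _ _ _ mwa_vac).
split=> [|k wc _]; first exact: (twisted_jacobi_weak_comm _ _ _ (jac u v)).
exact: (twisted_jacobi_weak_assoc _ _ _ _ nu_p (jac u v) wc).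
Qed.
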